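(* For every classical noncrossing partition $\pi$ for $B_n$ there exists a unique classical nonnesting partition $\pi'$ for $B_n$ with $a(\pi')=a(\pi)$, $\mu(\pi')=\mu(\pi)$ and $\nu(\pi')=\sigma_B(\nu(\pi))$; for every classical nonnesting partition $\pi'$ for $B_n$ there exists a unique classical noncrossing partition $\pi$ for $B_n$ satisfying these equalities; and any two such $\pi,\pi'$ have the same type.
   Context: Let $\Lambda=\{1,\dots,n,-1,\dots,-n,0\}$. For a subspace $L\subseteq\mathbb R^n$ that is an intersection of (possibly zero) hyperplanes $x_i=x_j$, $x_i=-x_j$ ($i\ne j$), $x_i=0$, let $\mathrm{Part}(L)$ be the partition of $\Lambda$ where, with $x_{-i}:=-x_i$, $x_0:=0$, elements $s,t$ are in the same block iff $x_s=x_t$ for all $x\in L$; these are the classical partitions for $B_n$. The block containing $0$ is the zero block. The type of $\mathrm{Part}(L)$ is the orbit of $L$ under all signed permutations of coordinates. For a partition $P$ and a total order $<$ on a ground set (elements not in the ground set are ignored), $G(P)$ has an edge $(s,s')$ when $s<s'$ lie in a common block with no element of that block strictly between. Noncrossing: no two edges $(a,c),(b,d)$ with $a<b<c<d$; nonnesting: no two edges $(a,d),(b,c)$ with $a<b<c<d$. A classical nonnesting partition for $B_n$ is a classical partition nonnesting w.r.t. $-n<\dots<-1<0<1<\dots<n$ (here $0$ is included); a classical noncrossing partition for $B_n$ is one noncrossing w.r.t. $-1<\dots<-n<1<\dots<n$. Statistics: a block is switching if it contains a positive and a nonpositive element ($0$ is nonpositive); positive nonswitching if all its elements are positive. With $M_1,\dots,M_m$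 the positive nonswitching blocks ordered by increasing least element, $a(\pi)=(\min M_1,\dots,\min M_m)$, $\mu(\pi)=(|M_1|,\dots,|M_m|)$; with $P_1,\dots,P_k$ the switching blocks ordered by increasing least positive element, $\nu(\pi)=(\nu_1,\dots,\nu_k)$ where $\nu_i$ is the number of positive elements of $P_i$. For $\nu=(\nu_1,\dots,\nu_k)$: if $k$ is odd, $\sigma_B(\nu)=(\nu_1,\dots,\nu_{(k-1)/2},\nu_{(k+3)/2},\dots,\nu_k,\nu_{(k+1)/2})$; if $k$ is even, $\sigma_B(\nu)=\nu$. *)

(* Defs.v *)
From HB Require Import structures.
From mathcomp Require Import all_boot all_order all_fingroup all_algebra.
From mathcomp Require Import boolp classical_sets reals.

Set Implicit Arguments.
Unset Strict Implicit.
Unset Printing Implicit Defensive.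

Import Order.TTheory GRing.Theory Num.Theory.
Local Open Scope ring_scope.

(* [None] is 0, [Some (false, i)] is the positive element i + 1 and
   [Some (true, i)] is its opposite -(i + 1), for i in {0, ..., n - 1}. *)
Definition Lambda (n : nat) : finType := option (bool * 'I_n).

Definition Lval n (s : Lambda n) : int :=
  if s is Some (b, i) then (-1) ^+ b * (i.+1)%:Z else 0.

Definition Lpos n (i : 'I_n) : Lambda n := Some (false, i).

Definition Lcoord (R : pzRingType) n (x : 'rV[R]_n) (s : Lambda n) : R :=
  if s is Some (b, i) then (-1) ^+ b * x 0 i else 0.

Definition B_hyperplane (R : realType) n (H : {vspace 'rV[R]_n}) : Prop :=
  [\/ exists i j : 'I_n, i != j /\ forall x, (x \in H) = (x 0 i == x 0 j),
      exists i j : 'I_n, i != j /\ forall x, (x \in H) = (x 0 i == - x 0 j)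
    | exists i : 'I_n, forall x, (x \in H) = (x 0 i == 0)].

Definition B_flat (R : realType) n (L : {vspace 'rV[R]_n}) : Prop :=
  exists Hs : seq {vspace 'rV[R]_n},
    (forall H, H \in Hs -> B_hyperplane H) /\ L = (\bigcap_(H <- Hs) H)%VS.

Definition Part (R : realType) n (L : {vspace 'rV[R]_n}) :
    {set {set Lambda n}} :=
  equivalence_partition
    (fun s t => `[< forall x, x \in L -> Lcoord x s = Lcoord x t >]) [set: Lambda n].

Definition classical_partition (R : realType) n (P : {set {set Lambda n}}) :
    Prop :=
  exists L : {vspace 'rV[R]_n}, B_flat L /\ P = Part L.

Definition signed_perm (R : pzRingType) n (p : 'S_n) (e : {ffun 'I_n -> bool})
    (x : 'rV[R]_n) : 'rV[R]_n :=
  \row_i ((-1) ^+ e i * x 0 (p i)).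

Fact signed_perm_is_linear (R : realType) n p e :
  linear (@signed_perm R n p e).
Proof.
by move=> k x y; apply/rowP => i; rewrite !mxE mulrDr !mulrA (commr_sign k).
Qed.

HB.instance Definition _ (R : realType) n p e :=
  GRing.isLinear.Build R 'rV[R]_n 'rV[R]_n *:%R (@signed_perm R n p e)
    (@signed_perm_is_linear R n p e).

Definition orbit_B (R : realType) n (L : {vspace 'rV[R]_n}) :
    set {vspace 'rV[R]_n} :=
  [set M | exists p e, M = (linfun (@signed_perm R n p e) @: L)%VS]%classic.

(* The type of Part(L) is the orbit of L; see [part_type_Part] below. *)
Definition part_type (R : realType) n (P : {set {set Lambda n}}) :
    set {vspace 'rV[R]_n} :=
  [set M | exists L, [/\ B_flat L, P = Part L & orbit_B L M]]%classic.
Arguments part_type R {n} P _.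

Lemma Part_mem (R : realType) n (L : {vspace 'rV[R]_n}) s t :
  (exists2 B, B \in Part L & (s \in B) && (t \in B)) <->
  (forall x, x \in L -> Lcoord x s = Lcoord x t).
Proof.
split=> [[B /imsetP[u _ ->]]|st].
  rewrite !inE /= => /andP[/asboolP us /asboolP ut] x xL.
  by rewrite -us // ut.
exists [set t | `[< forall x, x \in L -> Lcoord x s = Lcoord x t >]].
  by apply/imsetP; exists s => //; apply/setP => u; rewrite !inE.
by rewrite !inE; apply/andP; split; apply/asboolP.
Qed.

Lemma mem_bigcapv (R : realType) n (Hs : seq {vspace 'rV[R]_n}) x :
  (x \in (\bigcap_(H <- Hs) H)%VS) = all (fun H : {vspace _} => x \in H) Hs.
Proof.
by elim: Hs => [|H Hs IH]; rewrite ?big_nil ?memvf // big_cons memv_cap IH.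
Qed.

Lemma B_flat_sub (R : realType) n (L M : {vspace 'rV[R]_n}) :
  B_flat L -> Part L = Part M -> (M <= L)%VS.
Proof.
move=> [Hs [hHs LE]] PLM; apply/subvP => x xM.
rewrite LE mem_bigcapv; apply/allP => H HHs.
have LH y : y \in L -> y \in H by rewrite LE mem_bigcapv => /allP; apply.
have tr s t : (forall x, x \in L -> Lcoord x s = Lcoord x t) ->
    forall x, x \in M -> Lcoord x s = Lcoord x t.
  by move=> /Part_mem; rewrite PLM => /Part_mem.
case: (hHs _ HHs) => [[i [j [_ HE]]]|[i [j [_ HE]]]|[i HE]].
- have := tr (Some (false, i)) (Some (false, j)).
  rewrite /= HE => /(_ _ x xM); rewrite !mul1r => -> // y /LH.
  by rewrite HE !mul1r => /eqP.
- have := tr (Some (false, i)) (Some (true, j)).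
  rewrite /= HE => /(_ _ x xM); rewrite !mul1r mulN1r => -> // y /LH.
  by rewrite HE !mul1r mulN1r => /eqP.
- have := tr (Some (false, i)) None.
  rewrite /= HE => /(_ _ x xM); rewrite !mul1r => -> // y /LH.
  by rewrite HE !mul1r => /eqP.
Qed.

Lemma part_type_Part (R : realType) n (L : {vspace 'rV[R]_n}) :
  B_flat L -> part_type R (Part L) = orbit_B L.
Proof.
move=> fL; apply/seteqP; split=> M /= => [[K [fK PE oM]]|oM]; last by exists L.
suff -> : L = K by [].
by apply/eqP; rewrite eqEsubv !B_flat_sub.
Qed.

Section Diagrams.
Variables (n : nat) (D : {set Lambda n}) (lt : rel (Lambda n)).
Implicit Type P : {set {set Lambda n}}.

(* [D] is the ground set, totally ordered by [lt]. *)
Definition edge P (s t : Lambda n) : bool :=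
  [&& s \in D, t \in D, lt s t &
      [exists B in P, [&& s \in B, t \in B &
        [forall u in B, (u \in D) ==> ~~ (lt s u && lt u t)]]]].

Definition noncrossing P : Prop :=
  forall a b c d, lt a b -> lt b c -> lt c d -> ~ (edge P a c /\ edge P b d).

Definition nonnesting P : Prop :=
  forall a b c d, lt a b -> lt b c -> lt c d -> ~ (edge P a d /\ edge P b c).

End Diagrams.

Definition lt_nn n : rel (Lambda n) := fun s t => Lval s < Lval t.

(* -1 < ... < -n < 1 < ... < n on the nonzero elements *)
Definition lt_nc n : rel (Lambda n) := fun s t =>
  match s, t with
  | Some (b, i), Some (c, j) => if b == c then (i < j)%N else b
  | _, _ => false
  end.

Definition classical_nonnesting (R : realType) n (P : {set {set Lambda n}}) :
    Prop :=
  classical_partition R P /\ nonnesting [set: Lambda n] (@lt_nn n) P.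

Definition classical_noncrossing (R : realType) n (P : {set {set Lambda n}}) :
    Prop :=
  classical_partition R P /\ noncrossing [set~ (None : Lambda n)] (@lt_nc n) P.

Section Statistics.
Variable n : nat.
Implicit Types (B : {set Lambda n}) (P : {set {set Lambda n}}).

Definition switching B : bool :=
  [exists s in B, 0 < Lval s] && [exists s in B, Lval s <= 0].

Definition pos_nonswitching B : bool := [forall s in B, 0 < Lval s].

(* the positive elements of B, in increasing order *)
Definition pos_elems B : seq nat :=
  [seq (val i).+1 | i <- enum 'I_n & Lpos i \in B].

Definition least_pos B : nat := head 0%N (pos_elems B).

Definition by_least_pos : rel {set Lambda n} :=
  fun B C => (least_pos B <= least_pos C)%N.

(* Distinct blocks have distinct least positive elements, so these sorted
   lists do not depend on the enumeration of P. *)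
Definition nonswitching_blocks P : seq {set Lambda n} :=
  sort by_least_pos [seq B <- enum P | pos_nonswitching B].

Definition switching_blocks P : seq {set Lambda n} :=
  sort by_least_pos [seq B <- enum P | switching B].

Definition stat_a P : seq nat := [seq least_pos B | B <- nonswitching_blocks P].

Definition stat_mu P : seq nat := [seq #|B| | B <- nonswitching_blocks P].

Definition stat_nu P : seq nat :=
  [seq #|[set s in B | 0 < Lval s]| | B <- switching_blocks P].

End Statistics.

Definition sigma_B (nu : seq nat) : seq nat :=
  let m := (size nu)./2 in
  if odd (size nu) then take m nu ++ drop m.+1 nu ++ [:: nth 0%N nu m] else nu.

Definition matching n (pi pi' : {set {set Lambda n}}) : Prop :=
  [/\ stat_a pi' = stat_a pi, stat_mu pi' = stat_mu pi
    & stat_nu pi' = sigma_B (stat_nu pi)].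

(* Main.v *)
From HB Require Import structures.
Require Import Defs.
From mathcomp Require Import all_boot all_order all_fingroup all_algebra.
From mathcomp Require Import boolp classical_sets reals.
From mathcomp Require Import zify.

(* Both kinds of partitions are encoded by words. Let [k] be the number of
   switching blocks. Prefix the positive elements 1 < ... < n by [k] virtual
   positions, the j-th one belonging to the j-th switching block; it stands for
   the greatest nonpositive element of that block in the diagram. The partition is recovered
   from the resulting partition of [k + n] positions, because negation acts on
   the switching blocks in a forced way: in the noncrossing case it exchanges the
   blocks number i and k + 1 - i, so that the zero block is the middle one when [k]
   is odd; in the nonnesting case the zero block comes last and negation reverses
   the others. This is where [sigma_B] comes from.

   In a noncrossing (resp. nonnesting) partition each nonminimal position
   continues the block, among those still to be continued, whose last element
   is the latest (resp. earliest); these are the stack and queue disciplines, a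
   greedy rule with respect to a [key] on positions. Hence a word is determined by
   the sizes of the blocks placed at their least positions, i.e. by (a, mu, nu),
   and it exists if and only if these sizes satisfy a ballot condition. That
   condition does not depend on the key, nor on the order of the entries of nu. *)

Set Implicit Arguments.
Unset Strict Implicit.
Unset Printing Implicit Defensive.

Import Order.TTheory GRing.Theory Num.Theory.
Local Open Scope nat_scope.

(** * Greedy words *)

Lemma last_before (p : pred nat) s t : s < t -> p s ->
  exists x, [/\ s <= x, x < t, p x & forall u, x < u -> u < t -> ~~ p u].
Proof.
move=> st ps.
have ex : exists i, p i && (i < t) by exists s; rewrite ps.
have ub i : p i && (i < t) -> i <= t by case/andP=> _ /ltnW.
case: (ex_maxnP ex ub) => x /andP[px xt] xmax; exists x; split=> //.
  by apply: xmax; rewrite ps.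
move=> u xu ut; apply/negP => pu.
by have := xmax u; rewrite pu ut => /(_ isT); lia.
Qed.

Lemma first_after (p : pred nat) t d : t < d -> p d ->
  exists x, [/\ t < x, x <= d, p x & forall u, t < u -> u < x -> ~~ p u].
Proof.
move=> td pd.
have ex : exists i, p i && (t < i) by exists d; rewrite pd.
case: (ex_minnP ex) => x /andP[px xt] xmin; exists x; split=> //.
  by apply: xmin; rewrite pd.
move=> u xu ut; apply/negP => pu.
by have := xmin u; rewrite pu xu => /(_ isT); lia.
Qed.

Definition cnt (W : nat -> nat) t l := \sum_(s < t) (W s == l).

(** The arcs of the diagram, read on positions. *)
Definition wedge (W : nat -> nat) s t :=
  [/\ s < t, W s = W t & forall u, s < u -> u < t -> W u <> W t].

(* [W t] is the least element of the block of [t], and [c] records the size of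
   a block at its least element. *)
Definition block_word N (c W : nat -> nat) :=
  [/\ forall t, t < N -> W t <= t,
      forall l, l < N -> cnt W N l = c l
    & forall t, t < N -> 0 < c t -> W t = t].

(* Whenever a block is continued at [t], it is the one, among all blocks still
   to be continued, whose current last element has the largest key. *)
Definition greedy (key : nat -> nat) N (W : nat -> nat) :=
  forall x t y d, d < N -> wedge W x t -> wedge W y d -> y < t -> t < d ->
  ~ key x < key y.

Lemma cntS W t l : cnt W t.+1 l = cnt W t l + (W t == l).
Proof. by rewrite /cnt big_ord_recr. Qed.

Lemma eq_cnt W W' t l : (forall s, s < t -> W s = W' s) -> cnt W t l = cnt W' t l.
Proof. by move=> e; apply: eq_bigr => s _; rewrite e. Qed.

Lemma leq_cnt W s t l : s <= t -> cnt W s l <= cnt W t l.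
Proof.
move=> /subnKC <-; elim: (t - s) => [|d IH]; first by rewrite addn0.
by rewrite addnS cntS (leq_trans IH) // leq_addr.
Qed.

Lemma cnt_gt0 W s t l : s < t -> W s = l -> 0 < cnt W t l.
Proof.
by move=> st Wl; apply: leq_trans (leq_cnt _ _ st); rewrite cntS Wl eqxx addn1.
Qed.

Lemma cnt_occ W s t l : cnt W s l < cnt W t l ->
  exists d, [/\ s <= d, d < t & W d = l].
Proof.
elim: t => [|t IH]; first by rewrite {2}/cnt big_ord0.
rewrite cntS; case: eqP => [Wt|_].
  case: (leqP s t) => [|ts]; first by exists t.
  by have := @leq_cnt W t.+1 s l ts; rewrite cntS Wt eqxx; lia.
by rewrite addn0 => /IH[d [sd dt Wd]]; exists d; split=> //; lia.
Qed.

Lemma cnt_sum W t : (forall s, s < t -> W s <= s) ->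
  \sum_(l < t) cnt W t l = t.
Proof.
move=> Wle; rewrite exchange_big /= -[RHS]card_ord -sum1_card.
apply: eq_bigr => s _.
have Wt : W s < t by have := Wle s (ltn_ord s); have := ltn_ord s; lia.
rewrite (bigD1 (Ordinal Wt)) //= eqxx big1 // => l.
by rewrite -val_eqE /= eq_sym => /negbTE ->.
Qed.

(** * Uniqueness of greedy words with given block sizes *)

Section Uniqueness.
Variables (key : nat -> nat) (N : nat) (c : nat -> nat).
Hypothesis key_inj : forall s t, s < N -> t < N -> key s = key t -> s = t.

Lemma block_word_root W t : block_word N c W -> t < N ->
  [/\ W t <= t, W (W t) = W t & (W t == t) = (0 < c t)].
Proof.
move=> [W1 W2 W3] tN; have Wt := W1 t tN.
have WN : W t < N by lia.
have Wc : 0 < c (W t) by rewrite -W2 //; apply: cnt_gt0 tN _.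
split=> //; first exact: W3.
by apply/eqP/idP => [{1}<- //|/W3->].
Qed.

Lemma wedge_last W t : block_word N c W -> t < N -> c t = 0 ->
  exists2 x, wedge W x t & x < N.
Proof.
move=> Wc tN ct; have [Wt WWt] := block_word_root Wc tN.
rewrite ct /= => /negP nWt.
have Wlt : W t < t by rewrite ltn_neqAle Wt andbT; apply/negP.
have [|x [_ xt /eqP Wx xu]] := @last_before (fun s => W s == W t) _ _ Wlt.
  by rewrite WWt.
by exists x; [split=> // u ux ut; apply/eqP/xu|lia].
Qed.

(** Up to [t] the block [W' t] has the same elements in both words, and its total size is the same.
    As [W] does not continue it at [t], it must do so later; so [x'] was waiting at [t], and the
    greedy rule of [W] forbids a larger key. *)
Lemma greedy_le W W' t x x' : block_word N c W -> block_word N c W' ->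
  greedy key N W -> t < N -> (forall s, s < t -> W s = W' s) ->
  wedge W x t -> wedge W' x' t -> W t <> W' t -> ~ key x < key x'.
Proof.
move=> Wc Wc' gW tN eqW ext ext' nW.
have [xt Wx Wxu] := ext; have [xt' Wx' Wxu'] := ext'.
have WN' : W' t < N by have [] := block_word_root Wc' tN; lia.
have : cnt W t (W' t) < cnt W N (W' t).
  case: Wc Wc' => [_ -> // _] [_ <- // _].
  rewrite (eq_cnt _ eqW); apply: leq_trans (leq_cnt _ _ tN).
  by rewrite cntS eqxx addn1.
move=> /cnt_occ[d [td dN Wd]].
have {}td : t < d by rewrite ltn_neqAle td andbT; apply/eqP => dt; apply: nW; rewrite -Wd dt.
have [|e [te ed /eqP We eu]] := @first_after (fun s => W s == W' t) t d td.
  exact/eqP.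
apply: (gW x t x' e) => //; first by lia.
split; [lia|by rewrite eqW // We|move=> u ux ue].
case: (ltngtP u t) => [ut|tu|->]; rewrite We //; last exact/eqP/eu.
by rewrite eqW //; exact: Wxu'.
Qed.

(** At a first difference [t], the sizes decide whether [t] opens a block. If not, [greedy_le]
    applied both ways gives equal keys to the two continued positions, which therefore coincide. *)
Lemma greedy_unique W W' : block_word N c W -> block_word N c W' ->
  greedy key N W -> greedy key N W' -> forall t, t < N -> W t = W' t.
Proof.
move=> Wc Wc' gW gW'; elim/ltn_ind => t IH tN.
have eqW s : s < t -> W s = W' s by move=> st; apply: IH; lia.
case: (posnP (c t)) => [ct|ct]; last first.
  by case: Wc Wc' => [_ _ ->//] [_ _ ->].
have [x ext xN] := wedge_last Wc tN ct.
have [x' ext' xN'] := wedge_last Wc' tN ct.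
apply/eqP/negPn/negP => /eqP nW.
have le1 := greedy_le Wc Wc' gW tN eqW ext ext' nW.
have eqW' s : s < t -> W' s = W s by move=> /eqW.
have le2 := greedy_le Wc' Wc gW' tN eqW' ext' ext (nesym nW).
have xx' : x = x' by apply: key_inj => //; lia.
apply: nW; case: ext => [xt <- _]; case: ext' => [_ <- _].
by rewrite eqW // xx'.
Qed.
End Uniqueness.

(** * Existence of greedy words under the ballot condition *)

Section Existence.
Variables (key : nat -> nat) (N : nat) (c : nat -> nat).
(** The ballot condition: the blocks opened up to [t] have room for all the [t.+1] positions up to
    [t]. *)
Hypothesis ballot : forall t, t < N -> t < \sum_(s < t.+1) c s.
Hypothesis total : \sum_(s < N) c s = N.

(** The current last elements, before [t], of the blocks that are not yet full. *)
Let available (W : nat -> nat) t y :=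
  [/\ y < t, forall u, y < u -> u < t -> W u <> W y & cnt W t (W y) < c (W y)].

(** A prefix has no later arcs to compare with, so here the greedy rule refers to blocks that are
    not full instead of blocks continued later. *)
Let partial_greedy t (W : nat -> nat) :=
  [/\ forall s, s < t -> W s <= s,
      forall s, s < t -> 0 < c s -> W s = s,
      forall l, cnt W t l <= c l
    & forall x s y, s < t -> wedge W x s -> available W s y -> ~ key x < key y].

(** Position [t] opens a block if [c t] is positive; otherwise it continues the available block
    whose last element has the largest key. *)
Let partial_greedyS t W : t < N -> partial_greedy t W ->
  exists W', partial_greedy t.+1 W'.
Proof.
move=> tN [W1 W2 W3 W4].
pose upd v := fun s => if s == t then v else W s.
have upd_lt v s : s < t -> upd v s = W s by rewrite /upd ltn_neqAle => /andP[/negbTE ->].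
have updt v : upd v t = v by rewrite /upd eqxx.
have cnt_upd v s l : s <= t -> cnt (upd v) s l = cnt W s l.
  by move=> st; apply: eq_cnt => u us; apply: upd_lt; lia.
have avl v s y : s <= t -> available (upd v) s y -> available W s y.
  move=> st [ys nl]; rewrite cnt_upd // upd_lt; last by lia.
  move=> yc; split=> // u yu us; rewrite -[W u](upd_lt v) -?[W y](upd_lt v); try lia.
  exact: nl.
have key_lt v x s y : s < t -> wedge (upd v) x s -> available (upd v) s y ->
    ~ key x < key y.
  move=> st [xs Wx nx] /(avl _ _ _ (ltnW st)); apply: (W4 _ s) => //; split=> //.
    by rewrite -(upd_lt v) ?Wx ?upd_lt //; lia.
  move=> u xu us; rewrite -[W u](upd_lt v) -?[W s](upd_lt v); try lia; exact: nx.
have cntt0 : cnt W t t = 0.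
  by rewrite /cnt big1 // => s _; have := W1 s (ltn_ord s); have := ltn_ord s; case: eqP; lia.
case: (posnP (c t)) => [ct|ct]; last first.
  exists (upd t); split=> [s|s|l|x s y].
  - rewrite ltnS leq_eqVlt => /orP[/eqP->|st]; first by rewrite updt.
    by rewrite upd_lt ?W1.
  - rewrite ltnS leq_eqVlt => /orP[/eqP->|st]; first by rewrite updt.
    by rewrite upd_lt //; exact: W2.
  - rewrite cntS cnt_upd // updt; case: eqP => [<-|_]; first by rewrite cntt0.
    by rewrite addn0.
  - rewrite ltnS leq_eqVlt => /orP[/eqP->|]; last exact: key_lt.
    move=> [xt]; rewrite updt upd_lt // => Wx.
    by have := W1 x xt; lia.
(* Since [t] opens no block, the blocks opened earlier have total size greater than [t], while only
   [t] positions are filled: one of them is not full. *)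
have [y0 y0P] : exists y, available W t y.
  have [l lt lc] : exists2 l, l < t & cnt W t l < c l.
    have : \sum_(l < t) cnt W t l < \sum_(l < t) c l.
      by rewrite cnt_sum //; have := ballot tN; rewrite big_ord_recr /= ct addn0.
    case: (pselect (exists2 l, l < t & cnt W t l < c l)) => // nex.
    rewrite ltnNge => /negP[]; apply: leq_sum => l _.
    by rewrite leqNgt; apply/negP => lc; apply: nex; exists l.
  have Wl : W l = l by apply: W2 => //; lia.
  have [|x [_ xt /eqP Wx xu]] := @last_before (fun s => W s == l) _ _ lt; first exact/eqP.
  by exists x; split=> //; rewrite Wx // => u xlu ut; apply/eqP/xu.
pose a (y : 'I_t) := `[< available W t y >].
have y0t : y0 < t by case: y0P.
have ay0 : a (Ordinal y0t) by apply/asboolP.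
case: (arg_maxnP (fun y : 'I_t => key y) ay0) => y /asboolP yP ymax.
have [yt ylast yc] := yP.
exists (upd (W y)); split=> [s|s|l|x s u].
- rewrite ltnS leq_eqVlt => /orP[/eqP->|st]; last by rewrite upd_lt ?W1.
  by rewrite updt (leq_trans (W1 y yt)) // ltnW.
- rewrite ltnS leq_eqVlt => /orP[/eqP->|st]; first by rewrite ct.
  by rewrite upd_lt //; exact: W2.
- rewrite cntS cnt_upd // updt; case: eqP => [<-|_]; first by rewrite addn1.
  by rewrite addn0.
- rewrite ltnS leq_eqVlt => /orP[/eqP->|]; last exact: key_lt.
  move=> [xt]; rewrite updt upd_lt // => Wx xu /avl-/(_ (leqnn t)) uP.
  have -> : x = y :> nat.
    case: (ltngtP x y) => // [xy|yx].
      by have := xu y xy yt; rewrite upd_lt.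
    by have := ylast x yx xt.
  have ut : u < t by case: uP.
  have /ymax : a (Ordinal ut) by apply/asboolP.
  by move=> /= ?; lia.
Qed.

Lemma greedy_exists : exists W, block_word N c W /\ greedy key N W.
Proof.
have [W [W1 W2 W3 W4]] : exists W, partial_greedy N W.
  have: N <= N by []; move: {1 3}N; elim=> [|t IH] tN.
    exists id; split=> // l; by rewrite /cnt big_ord0.
  by have [W /(partial_greedyS tN)] := IH (ltnW tN).
(* Every count is at most its prescribed size and both families sum to [N], so they agree
   termwise. *)
have W5 l : l < N -> cnt W N l = c l.
  move=> lN; have [] := @leqif_sum _ (fun _ : 'I_N => true)
    (fun i => cnt W N i == c i) (fun i => cnt W N i) (fun i => c i).
    by move=> i _; apply/leqifP; case: ifPn => // ne; rewrite ltn_neqAle ne W3.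
  rewrite cnt_sum // total eqxx => _ /esym/forallP/(_ (Ordinal lN)) /=.
  by move/eqP.
exists W; split; first by split.
(* The occurrence at [d] of the letter of [y] shows that its block was not full at [t], so that [y]
   was available there. *)
move=> x t y d dN ext [yd Wy yu] yt td.
apply: (W4 x t y _ ext); first by lia.
split=> [//|u uy ut|]; first by rewrite Wy; apply: yu => //; lia.
have WyN : W y < N by have := W1 y; lia.
rewrite -W5 //; apply: leq_trans (leq_cnt _ _ dN); rewrite cntS -Wy eqxx addn1 ltnS.
by apply: leq_cnt; lia.
Qed.
End Existence.

(** * Signed equivalence relations *)

Section Crossings.
Variables (T : finType) (U : eqType) (key : T -> nat) (lab : T -> U).
Hypothesis key_inj : injective key.

Definition consecutive x y :=
  [/\ key x < key y, lab x = lab y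
    & forall z, lab z = lab x -> ~~ (key x < key z < key y)].

(** Take the last element of the class of [x] before [y] and the first one after [y]. *)
Lemma straddling_consecutive x y z :
  key x < key y -> key y < key z -> lab x = lab z -> lab y <> lab x ->
  exists x' z', [/\ consecutive x' z', lab x' = lab x, key x <= key x',
    key x' < key y & key y < key z' <= key z].
Proof.
move=> xy yz xz nyx.
pose p m := [exists t, (key t == m) && (lab t == lab x)].
have pP t : lab t = lab x -> p (key t).
  by move=> tx; apply/existsP; exists t; rewrite tx !eqxx.
have [u [xu uy /existsP[x' /andP[/eqP ku /eqP lx']] pu]] := last_before xy (pP x erefl).
have [v [yv vz /existsP[z' /andP[/eqP kv /eqP lz']] pv]] := first_after yz (pP z (esym xz)).
subst u v.
exists x', z'; split=> //; last by rewrite yv.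
split=> [||t]; [lia|by rewrite lx' lz'|rewrite lx' => tx].
apply/negP => /andP[xt tz].
have := pP _ tx; apply/negP.
case: (ltngtP (key t) (key y)) => [ty|yt|/key_inj ty].
- exact: pu.
- exact: pv.
- by rewrite -ty in nyx.
Qed.

(** Tighten the first pair around [b], then the second pair around the new right end [c']. Thus a
    condition on edges forbids crossings of arbitrary pairs taken in two blocks. *)
Lemma crossing_consecutive a b c d :
  key a < key b -> key b < key c -> key c < key d ->
  lab a = lab c -> lab b = lab d -> lab a <> lab b ->
  exists a' b' c' d', [/\ key a' < key b', key b' < key c', key c' < key d',
    consecutive a' c' & consecutive b' d'].
Proof.
move=> ab bc cd ac bd nab.
have [a' [c' [e' la' aa' ab' /andP[bc' cc']]]] :=
  straddling_consecutive ab bc ac (nesym nab).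
have cd' : key c' < key d by lia.
have lc' : lab c' = lab a by case: e' => _ <-.
have [|b' [d' [e2 lb' bb' bc2 /andP[cd2 dd']]]] := straddling_consecutive bc' cd' bd.
  by rewrite lc'.
by exists a', b', c', d'; split=> //; lia.
Qed.
End Crossings.

Section SignedEquivalences.
Variable n : nat.
Implicit Types (s t u : Lambda n) (e : rel (Lambda n)).

Definition Lneg (i : 'I_n) : Lambda n := Some (true, i).

Definition Lopp s : Lambda n := if s is Some (b, i) then Some (~~ b, i) else None.

Lemma LoppK : involutive Lopp.
Proof. by case=> [[b i]|] //=; rewrite negbK. Qed.

(** The combinatorial form of classical partitions: negation permutes the blocks, and a block that
    meets its opposite in some pair of opposite elements is the zero block. *)
Definition signed_equivalence e :=
  [/\ equivalence_rel e, forall s t, e s t -> e (Lopp s) (Lopp t)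
    & forall s, e s (Lopp s) -> e s None].

Definition rel_part e : {set {set Lambda n}} := equivalence_partition e [set: Lambda n].

Lemma rel_partE (e e' : rel (Lambda n)) : e =2 e' -> rel_part e = rel_part e'.
Proof.
by move=> ee'; apply: eq_imset => s; apply/setP => t; rewrite !inE ee'.
Qed.

Lemma mem_rel_part e (B : {set Lambda n}) :
  reflect (exists s, B = [set t | e s t]) (B \in rel_part e).
Proof.
apply: (iffP imsetP) => [[s _ ->]|[s ->]]; exists s => //; apply/setP => t; by rewrite !inE.
Qed.

Lemma Lcoord_opp (R : pzRingType) (x : 'rV[R]_n) s : Lcoord x (Lopp s) = (- Lcoord x s)%R.
Proof. by case: s => [[[] i]|] /=; rewrite ?oppr0 // !(mulN1r, mul1r, opprK). Qed.

Lemma classical_signed (R : realType) (P : {set {set Lambda n}}) :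
  classical_partition R P -> exists2 e, signed_equivalence e & P = rel_part e.
Proof.
move=> [L [_ ->]].
exists (fun s t => `[< forall x, x \in L -> Lcoord x s = Lcoord x t >]) => //; split.
- move=> s t u; split=> [|/asboolP st]; first exact/asboolP.
  by apply/asboolP/asboolP => H x xL; rewrite -?st -?H // st.
- move=> s t /asboolP H; apply/asboolP => x xL; by rewrite !Lcoord_opp H.
- move=> s /asboolP H; apply/asboolP => x xL.
  have := H x xL; rewrite Lcoord_opp /= => /eqP.
  by rewrite -addr_eq0 -mulr2n mulrn_eq0 /= => /eqP.
Qed.

Lemma Lcoord_linear (R : realType) s : linear_for *%R (fun x : 'rV[R]_n => Lcoord x s).
Proof.
move=> k x y; case: s => [[b i]|] /=; last by rewrite mulr0 addr0.
by rewrite !mxE mulrDr mulrCA.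
Qed.

(** The whole space covers the trivial equations, where [s] and [t] are equal; opposite nonzero [s]
    and [t] give the hyperplane on which a coordinate vanishes. *)
Lemma B_hyperplane_eq (R : realType) s t :
  exists H : {vspace 'rV[R]_n}, (forall x, (x \in H) = (Lcoord x s == Lcoord x t))
  /\ (B_hyperplane H \/ forall x, x \in H).
Proof.
have lf : linear_for *%R (fun x : 'rV[R]_n => Lcoord x s - Lcoord x t)%R.
  by move=> k x y; rewrite !Lcoord_linear opprD mulrBr addrACA.
pose g := HB.pack_for {linear 'rV[R]_n -> R^o} (fun x : 'rV[R]_n => Lcoord x s - Lcoord x t)%R
  (GRing.isLinear.Build R 'rV[R]_n R^o *:%R _ lf).
have HE x : (x \in lker (linfun g)) = (Lcoord x s == Lcoord x t).
  by rewrite memv_ker lfunE /= subr_eq0.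
move: (lker (linfun g)) HE => H HE; exists H; split=> //.
have o (r : R) : (r == - r)%R = (r == 0)%R by rewrite -addr_eq0 -mulr2n mulrn_eq0.
case: s t {g lf} HE => [[b i]|] [[c j]|] /= HE; last by right=> x; rewrite HE.
- have [ij|nij] := eqVneq i j.
    rewrite {}ij in HE; have [bc|nbc] := eqVneq b c.
      by right=> x; rewrite HE bc.
    left; apply: Or33; exists j => x; rewrite HE.
    by case: b c nbc HE => [] [] // _ _; rewrite mul1r mulN1r // eq_sym.
  left; have [bc|nbc] := eqVneq b c.
    apply: Or31; exists i, j; split=> // x; rewrite HE bc.
    by rewrite (inj_eq (mulfI _)) // signr_eq0.
  apply: Or32; exists i, j; split=> // x; rewrite HE.
  by case: b c nbc HE => [] [] // _ _; rewrite mul1r mulN1r // eqr_oppLR.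
- left; apply: Or33; exists i => x; rewrite HE.
  by rewrite mulf_eq0 signr_eq0.
- left; apply: Or33; exists j => x; rewrite HE.
  by rewrite eq_sym mulf_eq0 signr_eq0.
Qed.

Lemma B_flat_eqs (R : realType) (r : seq (Lambda n * Lambda n)) :
  exists2 L : {vspace 'rV[R]_n}, B_flat L &
  forall x, (x \in L) = all (fun p => Lcoord x p.1 == Lcoord x p.2) r.
Proof.
elim: r => [|[s t] r [L [Hs [hHs LE]] xL]].
  exists fullv; last by move=> x; rewrite memvf.
  by exists [::]; split=> //; rewrite big_nil.
have [H [HE [hH|fH]]] := B_hyperplane_eq R s t; last first.
  by exists L => [|x]; [exists Hs|rewrite xL /= -HE fH].
exists (H :&: L)%VS => [|x]; last by rewrite memv_cap xL HE.
exists (H :: Hs); split=> [K|]; last by rewrite big_cons LE.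
by rewrite inE => /orP[/eqP->|/hHs].
Qed.

(** The flat is cut out by all the equations that [e] prescribes. What needs proof is that it
    satisfies no further coordinate equality; test vectors attached to the blocks show this. *)
Lemma signed_flat (R : realType) e : signed_equivalence e ->
  exists L : {vspace 'rV[R]_n}, [/\ B_flat L, rel_part e = Part L &
    forall x, x \in L <-> forall s t, e s t -> Lcoord x s = Lcoord x t].
Proof.
move=> [eqe eopp e0].
have er : reflexive e by move=> s; case: (eqe s s s).
have eC1 s t : e s t -> e t s by move=> st; have [_ /(_ st) <-] := eqe s t s.
have eC s t : e s t = e t s by apply/idP/idP; apply: eC1.
have etr s t u : e s t -> e s u = e t u by move=> st; have [_ ->] := eqe s t u.
have [L fL LE] := B_flat_eqs R [seq p <- enum {: Lambda n * Lambda n} | e p.1 p.2].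
exists L; split=> //; last first.
  move=> x; rewrite LE; split=> [/allP H s t st|H].
    by apply/eqP; apply: (H (s, t)); rewrite mem_filter /= st mem_enum.
  by apply/allP => -[s t]; rewrite mem_filter /= => /andP[st _]; apply/eqP/H.
apply: rel_partE => s t; apply/idP/asboolP => [st x|H].
  rewrite LE => /allP/(_ (s, t)); rewrite mem_filter /= st mem_enum => /(_ isT).
  by move/eqP.
(* The signed indicator of the block of [u]: it is 1 on this block and -1 on its opposite, and
   vanishes if the two coincide. *)
pose chi u : 'rV[R]_n := (\row_i ((e u (Lpos i))%:R - (e u (Lneg i))%:R))%R.
have opp_e u v : e u (Lopp v) = e (Lopp u) v.
  by apply/idP/idP => /eopp; rewrite LoppK.
have chiE u v : Lcoord (chi u) v = ((e u v)%:R - (e u (Lopp v))%:R)%R.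
  case: v => [[b i]|] /=; last by rewrite subrr.
  rewrite mxE; case: b; rewrite /= ?mulN1r ?mul1r //.
  by rewrite opprB.
have chiL u : chi u \in L.
  rewrite LE; apply/allP => -[v w]; rewrite mem_filter /= => /andP[vw _].
  rewrite !chiE !(eC u) (etr _ _ _ vw).
  by rewrite (etr _ _ _ (eopp _ _ vw)).
(* If [s] lies in the zero block then [chi s] vanishes, so [chi t] is used: its coordinate at [s] is
   0, hence so is the one at [t], which puts [t] in the zero block. Otherwise [chi s] has coordinate
   1 at [s], hence at [t]. *)
have [/e0 s0|ns] := boolP (e s (Lopp s)).
  have := H _ (chiL t); rewrite !chiE er.
  have -> : e t (Lopp s) = e t s.
    by rewrite !(eC t) (etr _ _ _ s0) (etr _ _ _ (eopp _ _ s0)).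
  rewrite subrr => /esym/eqP; rewrite subr_eq0 eqr_nat.
  case tt: (e t (Lopp t)) => // _; rewrite (etr _ _ _ s0) eC.
  exact: e0.
have := H _ (chiL s); rewrite !chiE er (negbTE ns) subr0.
case: (e s t) => // /eqP; rewrite sub0r -addr_eq0.
by rewrite -(natrD _ 1) pnatr_eq0.
Qed.

Lemma signed_classical (R : realType) e :
  signed_equivalence e -> classical_partition R (rel_part e).
Proof. by move=> /(signed_flat R)[L [fL PL _]]; exists L. Qed.

Lemma edge_rel_part (D : {set Lambda n}) (lt : rel (Lambda n)) e s t :
  equivalence_rel e ->
  reflect [/\ s \in D, t \in D, lt s t, e s t &
    forall u, e s u -> u \in D -> ~~ (lt s u && lt u t)] (edge D lt (rel_part e) s t).
Proof.
move=> eqe; have er : reflexive e by move=> u; case: (eqe u u u).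
apply: (iffP and4P) => [[sD tD st /existsP[B]]|[sD tD st est H]].
  case/andP => /mem_rel_part[u ->]; rewrite !inE => /and3P[us ut /forallP H].
  have eE v : e s v = e u v by have [_ ->] := eqe u s v.
  split=> // [|v]; first by rewrite eE.
  by rewrite eE => uv vD; have := H v; rewrite inE uv vD.
split=> //; apply/existsP; exists [set v | e s v]; apply/andP; split.
  by apply/mem_rel_part; exists s.
rewrite !inE er est /=; apply/forallP => v; rewrite inE.
by apply/implyP => sv; apply/implyP; apply: H.
Qed.
End SignedEquivalences.

(** * From words to partitions *)

Section WordPartitions.
Variables (n k : nat).
Implicit Types (W tau c : nat -> nat) (s : Lambda n).

(* A letter [x < k] stands for the switching block number [x]; [tau] is the
   action of negation on these letters and [z] is the letter of the zero block,
   which has positive elements exactly when [k] is odd. *)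
Definition word_label W tau z s : option (bool * nat) :=
  if s is Some (b, i) then
    let x := W (k + i) in
    Some (if x < k then (false, if b then tau x else x) else (b, x))
  else if odd k then Some (false, z) else None.

Definition word_part W tau z :=
  rel_part (fun s t : Lambda n => word_label W tau z s == word_label W tau z t).

(** A block equal to its opposite is the zero block; hence the only possible fixed letter is [z],
    and there is none when [k] is even. *)
Definition zero_involution tau z :=
  [/\ forall x, x < k -> tau x < k, forall x, x < k -> tau (tau x) = x,
      odd k -> z < k /\ tau z = z
    & forall x, x < k -> tau x = x -> odd k /\ x = z].

Lemma eq_word_part W W' tau z : (forall t, t < k + n -> W t = W' t) ->
  word_part W tau z = word_part W' tau z.
Proof.
move=> eqW; have eql s : word_label W tau z s = word_label W' tau z s.
  by case: s => [[b i]|] //; rewrite /word_label eqW // ltn_add2l.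
by apply: rel_partE => s t; rewrite !eql.
Qed.

Lemma word_label_signed W tau z : zero_involution tau z ->
  signed_equivalence (fun s t : Lambda n => word_label W tau z s == word_label W tau z t).
Proof.
move=> [tauk tauK tauz tau_fix].
pose opp (l : option (bool * nat)) : option (bool * nat) :=
  if l is Some (b, x) then Some (if x < k then (false, tau x) else (~~ b, x)) else None.
have labN s : word_label W tau z (Lopp s) = opp (word_label W tau z s).
  case: s => [[b i]|] /=; last first.
    by case: ifP => // /tauz[zk tz] /=; rewrite zk tz.
  case: ifP => [xk|/negbT nxk] /=; last by rewrite (negbTE nxk).
  by case: b; rewrite /= ?tauk ?xk ?tauK.
split=> [s t u|s t /eqP st|s]; first by split=> // /eqP ->.
  by rewrite !labN st.
case: s => [[b i]|] //=; case: ifP => [xk|nxk]; last by case: b.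
move=> /eqP[] e.
have tx : tau (W (k + i)) = W (k + i) by case: b e.
by have [-> <-] := tau_fix _ xk tx; rewrite tx if_same.
Qed.

Lemma least_posE (B : {set Lambda n}) (i : 'I_n) : Lpos i \in B ->
  (forall j : 'I_n, Lpos j \in B -> i <= j) -> least_pos B = i.+1.
Proof.
move=> iB imin; rewrite /least_pos.
have srt : sorted leq (pos_elems B).
  rewrite sorted_map; apply: sorted_filter => [x y u|]; first exact: leq_trans.
  by have := iota_sorted 0 n; rewrite -val_enum_ord sorted_map.
have mem j : j \in pos_elems B -> i.+1 <= j.
  by move=> /mapP[u]; rewrite mem_filter => /andP[/imin iu _] ->.
have iin : i.+1 \in pos_elems B.
  by apply/mapP; exists i => //; rewrite mem_filter iB mem_enum.
case: (pos_elems B) srt mem iin => // x p /= xp mem; rewrite inE => /orP[/eqP ->//|ip].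
have /allP/(_ _ ip) := order_path_min leq_trans xp.
by have := mem x; rewrite mem_head => /(_ isT); lia.
Qed.

(** [by_least_pos] is only a preorder on sets; strictly increasing least elements make it
    antisymmetric on the blocks at hand, so the sorted list is unique. *)
Lemma sort_by_least_pos (s r : seq {set Lambda n}) : perm_eq s r ->
  sorted ltn (map (@least_pos n) r) -> sort (@by_least_pos n) s = r.
Proof.
move=> sr rs; have ru := sorted_uniq ltn_trans ltnn rs.
apply: (@sorted_eq_in _ (@by_least_pos n)).
- by move=> x y u _ _ _; apply: leq_trans.
- move=> x y; rewrite !mem_sort !(perm_mem sr) /by_least_pos => xr yr.
  rewrite -eqn_leq => /eqP exy; rewrite -(nth_index x xr) -(nth_index x yr).
  congr (nth _ _ _); apply: (uniqP 0 ru); rewrite ?inE ?size_map ?index_mem //.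
  by rewrite !(nth_map x) ?index_mem // !nth_index.
- by apply: sort_sorted => x y; apply: leq_total.
- by rewrite sorted_map in rs; apply: sub_sorted rs => x y /ltnW.
- by rewrite perm_sort.
Qed.

(** * The statistics of the partition of a word *)

Section Statistics.
Variables (W tau c : nat -> nat) (z : nat).
Hypothesis tauP : zero_involution tau z.
Hypothesis Wc : block_word (k + n) c W.
Hypothesis ck : forall j, j < k -> 1 < c j.
(** The first real elements of the switching blocks come in the order of their virtual positions, so
    that sorting by least positive element lists the letters 0, ..., k - 1 in order. *)
Hypothesis first_mono : forall i j t t', i < j -> j < k -> t < k + n -> t' < k + n ->
  wedge W i t -> wedge W j t' -> t < t'.

Let lab := word_label W tau z.
Let letter_block x := [set s | lab s == Some (false, x)].

Let Wk j : j < k -> W j = j.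
Proof. by move=> jk; case: Wc => _ _; apply; rewrite ?(ltnW (ck jk)); have := ck jk; lia. Qed.

Let lab_pos i : lab (Lpos i) = Some (false, W (k + i)).
Proof. by rewrite /lab /word_label /=; case: ifP. Qed.

Let pos_letter i x : (Lpos i \in letter_block x) = (W (k + i) == x).
Proof. by rewrite inE lab_pos; apply/eqP/eqP => [[]|->]. Qed.

(** The summand [x < k] accounts for the virtual position. *)
Lemma card_letter x : x < k + n -> (x < k) + #|[set i : 'I_n | W (k + i) == x]| = c x.
Proof.
case: Wc => _ W2 _ xN; rewrite -W2 // /cnt big_split_ord /=; congr (_ + _).
  under eq_bigr => j _ do rewrite Wk //.
  case: ltnP => [xk|kx]; last first.
    by rewrite big1 // => j _; have := ltn_ord j; case: eqP => //; lia.
  rewrite (bigD1 (Ordinal xk)) //= eqxx big1 // => j.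
  by rewrite -val_eqE /= => /negbTE ->.
by rewrite -sum1_card big_mkcond; apply: eq_bigr => i _; rewrite inE; case: eqP.
Qed.

Let letter_occ x : x < k -> exists i : 'I_n, W (k + i) = x.
Proof.
move=> xk; have xN : x < k + n by lia.
have /card_gt0P[i] : 0 < #|[set i : 'I_n | W (k + i) == x]|.
  by have := card_letter xN; have := ck xk; rewrite xk; lia.
by rewrite inE => /eqP; exists i.
Qed.

Let W_lt i : i < n -> W (k + i) < k + n.
Proof. by move=> i_n; case: Wc => /(_ (k + i)); rewrite ltn_add2l => /(_ i_n); lia. Qed.

Let nonpos_letter x s : k <= x -> s \in letter_block x -> exists i, s = Lpos i.
Proof.
have [tauk _ tauz _] := tauP.
move=> kx; rewrite inE; case: s => [[[] i]|] /=.
- by rewrite /lab /word_label; case: ifP => [/tauk|] H /eqP[] //; lia.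
- by exists i.
- by rewrite /lab /word_label; case: ifP => // /tauz[H _] /eqP[]; lia.
Qed.

Let neg_letter x : x < k -> exists i, Lneg i \in letter_block x.
Proof.
have [tauk tauK _ _] := tauP.
move=> xk; have [i Wi] := letter_occ (tauk _ xk).
by exists i; rewrite inE /lab /word_label /= Wi tauk // tauK.
Qed.

Let Lval_gt0 s : (0 < Lval s)%R -> exists i, s = Lpos i.
Proof. by case: s => [[[] i]|] //=; exists i. Qed.

Let part_pos B i : B \in word_part W tau z -> Lpos i \in B ->
  B = letter_block (W (k + i)).
Proof.
move=> /mem_rel_part[s ->]; rewrite inE => /eqP si; apply/setP => t.
by rewrite !inE si -lab_pos eq_sym.
Qed.

Let letter_part (i : 'I_n) : letter_block (W (k + i)) \in word_part W tau z.
Proof.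
apply/mem_rel_part; exists (Lpos i); apply/setP => t.
by rewrite !inE -lab_pos eq_sym.
Qed.

Let letter_inj (i : 'I_n) x y : W (k + i) = x -> letter_block x = letter_block y -> x = y.
Proof. by move=> Wx /setP/(_ (Lpos i)); rewrite !pos_letter Wx eqxx => /esym/eqP. Qed.

Let least_first x : x < k -> exists2 i : 'I_n, wedge W x (k + i) &
  least_pos (letter_block x) = i.+1.
Proof.
move=> xk; have [i0 Wi0] := letter_occ xk.
(* [k.-1] is the last virtual position, so the search runs over the real positions only. *)
have [||t [kt ti0 /eqP Wt tu]] := @first_after (fun u => W u == x) k.-1 (k + i0).
- by lia.
- exact/eqP.
have tn : t - k < n by have := ltn_ord i0; lia.
have kt' : k + (t - k) = t by lia.
exists (Ordinal tn) => /=.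
  rewrite kt'; split; [lia|by rewrite Wt Wk|move=> u xu ut].
  rewrite Wt; case: (ltnP u k) => uk; first by rewrite Wk //; lia.
  by apply/eqP/tu; lia.
rewrite (@least_posE _ (Ordinal tn)) //; first by rewrite pos_letter /= kt' Wt.
move=> j; rewrite pos_letter leqNgt => Wj; apply/negP => /= jt.
by have /negP[] := tu (k + j) ltac:(lia) ltac:(lia).
Qed.

Let least_root x : k <= x -> x < k + n -> 0 < c x -> least_pos (letter_block x) = (x - k).+1.
Proof.
move=> kx xN cx; have xn : x - k < n by lia.
have kx' : k + (x - k) = x by lia.
case: Wc => W1 W2 W3.
rewrite (@least_posE _ (Ordinal xn)) //; first by rewrite pos_letter /= kx' W3.
move=> j; rewrite pos_letter => /eqP Wj /=.
by have := W1 (k + j); rewrite Wj ltn_add2l ltn_ord => /(_ isT); lia.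
Qed.

Let root_letters := [seq x <- iota k n | 0 < c x].

Let root_lettersP x : x \in root_letters = [&& k <= x, x < k + n & 0 < c x].
Proof. by rewrite mem_filter mem_iota andbC -andbA. Qed.

Let nonswitchingE : nonswitching_blocks (word_part W tau z) = map letter_block root_letters.
Proof.
have occ x : x \in root_letters -> exists i : 'I_n, W (k + i) = x.
  rewrite root_lettersP => /and3P[kx xN cx]; have xn : x - k < n by lia.
  by exists (Ordinal xn); case: Wc => _ _ /=; rewrite subnKC //; apply.
apply: sort_by_least_pos.
  apply: uniq_perm.
  - by rewrite filter_uniq // enum_uniq.
  - rewrite map_inj_in_uniq; first by rewrite filter_uniq // iota_uniq.
    by move=> x y /occ[i Wi] _; apply: letter_inj Wi.
  move=> B; rewrite mem_filter mem_enum; apply/andP/mapP => [[/forallP pB BP]|[x xr ->]].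
    have [s sB] : exists s, s \in B.
      by case/mem_rel_part: BP => s ->; exists s; rewrite inE.
    have /Lval_gt0[i si] : (0 < Lval s)%R by have := pB s; rewrite sB.
    rewrite {}si in sB; have Bi := part_pos BP sB; exists (W (k + i)) => //.
    rewrite root_lettersP W_lt // leqNgt; case: ltnP => [xk|kx].
      have [j] := neg_letter xk; rewrite -Bi => jB.
      by have := pB (Lneg j); rewrite jB.
    case: Wc => _ W2 _; rewrite /= -W2 ?W_lt //.
    by apply: (@cnt_gt0 _ (k + i)); rewrite ?ltn_add2l.
  have [i Wi] := occ x xr; split; last by rewrite -Wi letter_part.
  apply/forallP => s; apply/implyP => sx.
  by have [|j -> //] := nonpos_letter _ sx; move: xr; rewrite root_lettersP => /andP[].
rewrite -map_comp; have -> : map (@least_pos n \o letter_block) root_letters =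
    map (fun x => (x - k).+1) root_letters.
  by apply/eq_in_map => x; rewrite root_lettersP => /and3P[? ? ?] /=; apply: least_root.
rewrite sorted_map; apply: (@sub_in_sorted _ (fun x => x \in root_letters) ltn).
- by move=> x y; rewrite -!topredE /= !root_lettersP /=; lia.
- exact/allP.
- by apply: sorted_filter (iota_ltn_sorted _ _); apply: ltn_trans.
Qed.

Let switchingE : switching_blocks (word_part W tau z) = map letter_block (iota 0 k).
Proof.
apply: sort_by_least_pos.
  apply: uniq_perm.
  - by rewrite filter_uniq // enum_uniq.
  - rewrite map_inj_in_uniq ?iota_uniq // => x y.
    by rewrite mem_iota /= => /letter_occ[i Wi] _; apply: letter_inj Wi.
  move=> B; rewrite mem_filter mem_enum.
  apply/andP/mapP => [[/andP[/existsP[s /andP[sB]]]]|[x xr ->]].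
    move=> /Lval_gt0[i si]; rewrite {}si in sB.
    move=> /existsP[t /andP[tB tle]] BP.
    have Bi := part_pos BP sB; exists (W (k + i)) => //.
    rewrite mem_iota /= add0n ltnNge; apply/negP => kx.
    by rewrite Bi in tB; have [j tj] := nonpos_letter kx tB; rewrite tj in tle.
  move: xr; rewrite mem_iota /= => xk.
  have [i Wi] := letter_occ xk; have [j jx] := neg_letter xk.
  split; last by rewrite -Wi letter_part.
  apply/andP; split; apply/existsP.
    by exists (Lpos i); rewrite pos_letter Wi eqxx.
  by exists (Lneg j); rewrite jx /= mulN1r.
rewrite -map_comp sorted_map; apply: (@sub_in_sorted _ (fun x => x \in iota 0 k) ltn).
- move=> x y; rewrite -!topredE /= !mem_iota /= => xk yk xy.
  have [i wi ->] := least_first xk; have [j wj ->] := least_first yk.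
  have iN : k + i < k + n by rewrite ltn_add2l.
  have jN : k + j < k + n by rewrite ltn_add2l.
  by have := first_mono xy yk iN jN wi wj; lia.
- exact/allP.
- exact: iota_ltn_sorted.
Qed.

Let pos_letterE x : [set s in letter_block x | (0 < Lval s)%R] =
  @Lpos n @: [set i : 'I_n | W (k + i) == x].
Proof.
apply/setP => s; apply/idP/imsetP => [|[i]].
  rewrite inE => /andP[sx /Lval_gt0[i si]]; exists i => //.
  by rewrite inE -pos_letter -si.
by rewrite inE => /eqP Wi ->; rewrite inE pos_letter Wi eqxx.
Qed.

Let card_pos_letter x :
  #|[set s in letter_block x | (0 < Lval s)%R]| = #|[set i : 'I_n | W (k + i) == x]|.
Proof. by rewrite pos_letterE card_imset // => i j []. Qed.

Lemma word_stat_a :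
  stat_a (word_part W tau z) = [seq (x - k).+1 | x <- iota k n & 0 < c x].
Proof.
rewrite /stat_a nonswitchingE -map_comp; apply/eq_in_map => x.
by rewrite root_lettersP => /and3P[? ? ?] /=; apply: least_root.
Qed.

Lemma word_stat_mu : stat_mu (word_part W tau z) = [seq c x | x <- iota k n & 0 < c x].
Proof.
rewrite /stat_mu nonswitchingE -map_comp; apply/eq_in_map => x.
rewrite root_lettersP => /and3P[kx xN cx] /=.
rewrite -card_letter // ltnNge kx add0n -card_pos_letter.
apply: eq_card => s; rewrite !inE; apply/esym/andb_idr => sx.
by have [|i ->//] := @nonpos_letter x s kx; rewrite inE.
Qed.

Lemma word_stat_nu : stat_nu (word_part W tau z) = [seq (c x).-1 | x <- iota 0 k].
Proof.
rewrite /stat_nu switchingE -map_comp; apply/eq_in_map => x.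
rewrite mem_iota /= => xk.
by rewrite card_pos_letter -card_letter ?xk //; lia.
Qed.
End Statistics.
End WordPartitions.

(* The key reverses the virtual positions: the greatest negative elements of the
   switching blocks of a noncrossing partition decrease. *)
Definition nc_key k t := if t < k then k - t.+1 else t.
Definition nc_tau k x := k - x.+1.
Definition nc_zero k := k./2.

(** Earlier positions have larger keys, so the greedy rule is the queue discipline. *)
Definition nn_key N t := N - t.
(** [k./2.*2] is the number of switching blocks other than the zero block. They are reversed, and a
    remaining last letter is fixed. *)
Definition nn_tau k x := if x < k./2.*2 then k./2.*2 - x.+1 else x.
Definition nn_zero k := k.-1.

Lemma nc_involution k : zero_involution k (nc_tau k) (nc_zero k).
Proof.
rewrite /nc_tau /nc_zero; have := odd_double_half k.
by case: (odd k) => kE; split=> [x xk|x xk|o|x xk xfix] //; try split; lia.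
Qed.

Lemma nn_involution k : zero_involution k (nn_tau k) (nn_zero k).
Proof.
rewrite /nn_tau /nn_zero; have := odd_double_half k; move: (k./2) => h kE.
have o1 : odd k -> k = h.*2.+1 by move=> o; rewrite -kE o.
have o0 : ~~ odd k -> k = h.*2 by move=> /negbTE o; rewrite -kE o.
split=> [x xk|x xk|/o1 kh|x xk].
- by case: ifP; lia.
- case: (ltnP x h.*2) => xh; first by rewrite ifT; lia.
  by rewrite ifF //; lia.
- by rewrite ifF; lia.
- case: ifP => xh; first by lia.
  by move=> _; case: (boolP (odd k)) => [/o1|/o0] H; split=> //; lia.
Qed.

Lemma nc_key_inj k s t : nc_key k s = nc_key k t -> s = t.
Proof. by rewrite /nc_key; do 2 case: ifP; lia. Qed.

Lemma nn_key_inj N s t : s < N -> t < N -> nn_key N s = nn_key N t -> s = t.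
Proof. by rewrite /nn_key; lia. Qed.

Section GreedyWords.
Variables (n k : nat) (W c : nat -> nat).
Hypothesis Wc : block_word (k + n) c W.
Hypothesis ck : forall j, j < k -> 1 < c j.

Lemma virtual_letter j : j < k -> W j = j.
Proof. by move=> jk; case: Wc => _ _; apply; have := ck jk; lia. Qed.

(** If block [j] were first continued before block [i], then [i] would be waiting at that moment
    with a larger key than [j]. *)
Lemma greedy_first_mono key :
  (forall i j, i < j -> j < k -> key j < key i) -> greedy key (k + n) W ->
  forall i j t t', i < j -> j < k -> t < k + n -> t' < k + n ->
  wedge W i t -> wedge W j t' -> t < t'.
Proof.
move=> key_dec gW i j t t' ij jk tN tN' wi wj.
case: (ltngtP t t') => // [tt'|tt'].
  case: (wj) => jt' _ _.
  by case: (gW _ _ _ _ tN wj wi _ tt'); [lia|exact: key_dec].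
case: wi wj => [_ + _] [_ + _].
by rewrite -tt' (virtual_letter jk) (virtual_letter (ltn_trans ij jk)); lia.
Qed.

Lemma nc_first_mono : greedy (nc_key k) (k + n) W ->
  forall i j t t', i < j -> j < k -> t < k + n -> t' < k + n ->
  wedge W i t -> wedge W j t' -> t < t'.
Proof.
apply: greedy_first_mono => i j ij jk; rewrite /nc_key; do 2 case: ifP; lia.
Qed.

Lemma nn_first_mono : greedy (nn_key (k + n)) (k + n) W ->
  forall i j t t', i < j -> j < k -> t < k + n -> t' < k + n ->
  wedge W i t -> wedge W j t' -> t < t'.
Proof. by apply: greedy_first_mono => i j ij jk; rewrite /nn_key; lia. Qed.

Lemma word_label_same tau z b (i j : 'I_n) : zero_involution k tau z ->
  (word_label k W tau z (Some (b, i)) == word_label k W tau z (Some (b, j))) =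
  (W (k + i) == W (k + j)).
Proof.
move=> [tauk tauK _ _]; apply/eqP/eqP => [|e]; last by rewrite /word_label e.
rewrite /word_label; case: b; case: ifP => ik; case: ifP => jk // -[] // e.
by rewrite -(tauK _ ik) e tauK.
Qed.

Lemma word_label_opp tau z (i j : 'I_n) : zero_involution k tau z ->
  (word_label k W tau z (Lneg i) == word_label k W tau z (Lpos j)) =
  (W (k + i) < k) && (W (k + j) == tau (W (k + i))).
Proof.
move=> [tauk tauK _ _]; rewrite /word_label /=.
apply/eqP/andP => [|[ik /eqP e]]; last by rewrite ik e tauk.
by case: ifP => ik; case: ifP => jk [] // e; [rewrite e|have := tauk _ ik; lia].
Qed.

Section Noncrossing.
Hypothesis gW : greedy (nc_key k) (k + n) W.

(** Positions are compared by key, so the virtual ones are reversed. A crossing reduces to two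
    crossing arcs; when the first arc is closed, the other one is waiting with a larger key, against
    greediness. *)
Lemma nc_word_noncrossing a b c' d : a < k + n -> b < k + n -> c' < k + n -> d < k + n ->
  nc_key k a < nc_key k b -> nc_key k b < nc_key k c' -> nc_key k c' < nc_key k d ->
  W a = W c' -> W b = W d -> W a = W b.
Proof.
move=> aN bN cN dN ab bc cd ac bd; apply/eqP/negPn/negP => /eqP nab.
have kinj : injective (fun x : 'I_(k + n) => nc_key k x).
  by move=> x y /nc_key_inj /val_inj.
have keyR u : k <= u -> nc_key k u = u by rewrite /nc_key ltnNge => ->.
have wedgeP (x t : 'I_(k + n)) :
    consecutive (fun x : 'I_(k + n) => nc_key k x) (fun x : 'I_(k + n) => W x) x t ->
    k <= t /\ wedge W x t.
  move=> [/= xt Wxt xu].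
  (* Distinct virtual positions carry distinct letters and precede all real positions in the order
     of keys, so an arc ends at a real position. *)
  have kt : k <= t.
    rewrite leqNgt; apply/negP => tk; move: xt; rewrite /nc_key tk.
    case: ifP => xk; last by lia.
    by move: Wxt; rewrite !virtual_letter //; lia.
  split=> //; move: xt; rewrite (keyR t) // => xt.
  have xt' : x < t by move: xt; rewrite /nc_key; case: ifP; lia.
  split=> // u ux ut Wu.
  have ku : k <= u.
    rewrite leqNgt; apply/negP => uk; have := Wxt.
    by rewrite -Wu !virtual_letter //; lia.
  have uN : u < k + n by have := ltn_ord t; lia.
  have := xu (Ordinal uN) ltac:(by rewrite /= Wu).
  rewrite /= (keyR t) // (keyR u) // ut andbT => /negP[].
  by rewrite /nc_key; case: ifP; lia.
have [a' [b' [c'' [d' [ab' bc' cd' /wedgeP[kc wac] /wedgeP[kd wbd]]]]]] :=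
  @crossing_consecutive _ _ _ (fun x : 'I_(k + n) => W x) kinj (Ordinal aN) (Ordinal bN)
    (Ordinal cN) (Ordinal dN) ab bc cd ac bd nab.
move: ab' bc' cd' => /= ab' bc' cd'.
apply: (gW (ltn_ord d') wac wbd _ _ ab').
  by move: bc'; rewrite (keyR c'') // /nc_key; case: ifP; lia.
by move: cd'; rewrite !keyR.
Qed.

Lemma nc_word_part :
  noncrossing [set~ (None : Lambda n)] (@lt_nc n) (word_part n k W (nc_tau k) (nc_zero k)).
Proof.
have tauP := nc_involution k.
have [eqe _ _] := word_label_signed n W tauP.
have keyk i : nc_key k (k + i) = k + i by rewrite /nc_key ltnNge leq_addr.
have iN (i : 'I_n) : k + i < k + n by rewrite ltn_add2l.
have keyv x : x < k -> nc_key k x = k - x.+1 by rewrite /nc_key => ->.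
move=> a b c' d ab bc cd [/edge_rel_part-/(_ eqe)[_ _ _ ac acu]].
move=> /edge_rel_part-/(_ eqe)[bD _ _ bd _].
have /negP nab : ~~ (word_label k W (nc_tau k) (nc_zero k) a ==
    word_label k W (nc_tau k) (nc_zero k) b).
  by apply/negP => ab'; have := acu b ab' bD; rewrite ab bc.
clear acu bD eqe; move: a b c' d ab bc cd ac bd nab.
move=> [[ba a]|] // [[bb b]|] // [[bc c']|] // [[bd d]|] //.
(* Five sign patterns are compatible with the order. The elements of one sign are read at the
   positions [k + i]; for an edge from a negative to a positive element, the end of the other sign
   is replaced by the virtual position of the letter. *)
case: ba; case: bb => //; case: bc => //; case: bd => // ab bc cd; simpl in ab, bc, cd.
- rewrite !word_label_same // => /eqP ac /eqP bd; apply; apply/eqP.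
  by apply: (@nc_word_noncrossing _ _ (k + c') (k + d)); rewrite ?keyk // ltn_add2l.
- rewrite word_label_same // word_label_opp // => /eqP ac /andP[bk /eqP bd].
  rewrite word_label_same //; apply; apply/eqP.
  rewrite -[RHS](virtual_letter bk); apply/esym.
  apply: (@nc_word_noncrossing _ _ (k + b) (k + c')); rewrite ?keyk ?keyv ?ltn_add2l //; try lia.
  by rewrite virtual_letter.
- rewrite !word_label_opp // => /andP[ak /eqP ac] /andP[bk /eqP bd].
  rewrite word_label_same // => nab.
  have nab' : W (k + a) <> W (k + b) by move=> e; apply: nab; rewrite e.
  rewrite /nc_tau in ac bd.
  (* Both edges change sign. Either the virtual positions of the letters of [a] and [b] come in
     crossing order with [a] and [b], or, because [nc_tau] reverses the letters, those of [c'] and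
     [d] do so with [c'] and [d]. *)
  case: (ltnP (W (k + b)) (W (k + a))) => ba.
    apply: nab'; rewrite -(virtual_letter ak) -(virtual_letter bk).
    apply: (@nc_word_noncrossing _ _ (k + a) (k + b)); rewrite ?keyk ?keyv ?ltn_add2l //; try lia.
    - by rewrite virtual_letter.
    - by rewrite virtual_letter.
  have ck' : W (k + c') < k by lia.
  have dk' : W (k + d) < k by lia.
  suff : W (W (k + c')) = W (W (k + d)) by rewrite (virtual_letter ck') (virtual_letter dk'); lia.
  apply: (@nc_word_noncrossing _ _ (k + c') (k + d)); rewrite ?keyk ?keyv ?ltn_add2l //; try lia.
  - by rewrite virtual_letter.
  - by rewrite virtual_letter.
- rewrite word_label_same // !word_label_opp // => /andP[ak /eqP ac] /eqP bd; apply.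
  rewrite ak -ac; apply/eqP.
  have ck' : W (k + c') < k by rewrite ac /nc_tau; lia.
  rewrite -[RHS](virtual_letter ck'); apply/esym.
  apply: (@nc_word_noncrossing _ _ (k + c') (k + d)); rewrite ?keyk ?keyv ?ltn_add2l //; try lia.
  by rewrite virtual_letter.
- rewrite !word_label_same // => /eqP ac /eqP bd; apply; apply/eqP.
  by apply: (@nc_word_noncrossing _ _ (k + c') (k + d)); rewrite ?keyk // ltn_add2l.
Qed.
End Noncrossing.
End GreedyWords.

Lemma lt_nnE n (s t : Lambda n) : lt_nn s t =
  match s, t with
  | Some (false, i), Some (false, j) => i < j
  | Some (true, i), Some (true, j) => j < i
  | Some (b, _), _ => b
  | None, Some (b, _) => ~~ b
  | None, None => false
  end.
Proof.
by rewrite /lt_nn; case: s t => [[[] i]|] [[[] j]|]; rewrite /= ?mul1r ?mulN1r; lia.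
Qed.

Lemma lt_nn_opp n (s t : Lambda n) : lt_nn (Lopp s) (Lopp t) = lt_nn t s.
Proof. by rewrite !lt_nnE; case: s t => [[[] i]|] [[[] j]|]. Qed.

Lemma lt_nn_pos n (i j : 'I_n) : lt_nn (Lpos i) (Lpos j) = (i < j).
Proof. by rewrite lt_nnE. Qed.

Lemma lt_nn_neg n (i j : 'I_n) : lt_nn (Lneg i) (Lneg j) = (j < i).
Proof. by rewrite lt_nnE. Qed.

(** * Words with the queue discipline give nonnesting partitions *)

Section GreedyNonnesting.
Variables (n k : nat) (W c : nat -> nat).
Hypothesis Wc : block_word (k + n) c W.
Hypothesis ck : forall j, j < k -> 1 < c j.
Hypothesis gW : greedy (nn_key (k + n)) (k + n) W.

Let lab := @word_label n k W (nn_tau k) (nn_zero k).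
Let tauP := nn_involution k.

Let lab_same b i j : lab (Some (b, i)) = lab (Some (b, j)) <-> W (k + i) = W (k + j).
Proof.
have := word_label_same W b i j tauP; rewrite -/lab => e.
by split=> /eqP H; apply/eqP; rewrite ?e // -?e.
Qed.

Let arc s t := [/\ lt_nn s t, lab s = lab t
  & forall u, lab s = lab u -> ~~ (lt_nn s u && lt_nn u t)].

Let arc_opp s t : arc s t -> arc (Lopp t) (Lopp s).
Proof.
have [_ eopp _] := word_label_signed n W tauP.
have labN u v : lab u = lab v -> lab (Lopp u) = lab (Lopp v).
  by move=> /eqP/eopp/eqP.
move=> [st est H]; split; [by rewrite lt_nn_opp|by apply: labN|].
move=> u /labN; rewrite LoppK => tu; have := H (Lopp u) (etrans est tu).
by rewrite -(LoppK u) !lt_nn_opp LoppK andbC.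
Qed.

Let iN (i : 'I_n) : k + i < k + n.
Proof. by rewrite ltn_add2l. Qed.

Let arc_pos i j : arc (Lpos i) (Lpos j) -> wedge W (k + i) (k + j).
Proof.
move=> []; rewrite lt_nn_pos => ij /lab_same Wij H.
split=> [|//|u iu uj Wu]; first by rewrite ltn_add2l.
have un : u - k < n by have := ltn_ord j; lia.
have := H (Lpos (Ordinal un)); rewrite !lt_nn_pos.
have -> : i < Ordinal un by rewrite /=; lia.
have -> : Ordinal un < j by rewrite /=; lia.
by move=> /(_ _)/negP[] //; apply: (iffRL (lab_same false _ _)); rewrite /= subnKC ?Wij ?Wu //; lia.
Qed.

Let wedge_virtual x (j : 'I_n) : x < k -> W (k + j) = x ->
  (forall i : 'I_n, i < j -> W (k + i) <> x) -> wedge W x (k + j).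
Proof.
move=> xk Wj H; split; [lia|by rewrite Wj (virtual_letter Wc ck)|].
move=> u xu uj; rewrite Wj; case: (ltnP u k) => uk; first by rewrite (virtual_letter Wc ck) //; lia.
have un : u - k < n by have := ltn_ord j; lia.
have := H (Ordinal un); rewrite /= subnKC //; apply; lia.
Qed.

(** The arc joins consecutive elements of its block, so [j] is the least positive one and [s] the
    greatest nonpositive one: this is 0 in the zero block, and otherwise minus the least positive
    element of the opposite block. *)
Let arc_switch s j : arc s (Lpos j) -> ~~ lt_nn None s ->
  let x := W (k + j) in
  [/\ x < k, wedge W x (k + j) &
    (s = None /\ (odd k /\ x = nn_zero k)) \/
    (exists i, [/\ s = Lneg i, nn_tau k x <> x & wedge W (nn_tau k x) (k + i)])].
Proof.
have [tauk tauK tauz tau_fix] := tauP.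
move=> [_ lsj H] s0 x.
have Hj : x < k -> wedge W x (k + j).
  move=> xk; apply: wedge_virtual => // i ij Wi; have := H (Lpos i).
  rewrite lsj lt_nn_pos ij; have -> : lt_nn s (Lpos i).
    by move: s0; rewrite !lt_nnE; case: (s) => [[[] ?]|].
  by case/(_ _)/negP => //; apply: (iffRL (lab_same false _ _)); rewrite Wi.
case: s s0 lsj H => [[b i]|] s0 lsj H.
  case: b s0 lsj H => [_|]; last by rewrite lt_nnE.
  move=> /eqP; rewrite word_label_opp // => /andP[ik /eqP xE] H.
  have xk : x < k by rewrite /x xE; apply: tauk.
  have tx : nn_tau k x = W (k + i) by rewrite /x xE tauK.
  split; [by []|exact: Hj|right; exists i; split=> //].
    move=> /(tau_fix _ xk)[ok xz]; have := H None.
    rewrite !lt_nnE /=; case/(_ _)/negP => //.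
    by rewrite /lab /word_label /= ok ik -tx tauK // xz.
  rewrite tx; apply: wedge_virtual => // i' ii' Wi'; have := H (Lneg i').
  rewrite lt_nn_neg ii' lt_nnE; case/(_ _)/negP => //.
  by apply: (iffRL (lab_same true _ _)); rewrite Wi'.
move: lsj; rewrite /lab /word_label /=; case: ifP => // ok.
have [zk tz] := tauz ok.
rewrite -/x; case: ifP => [xk|xk] [] xz; last by lia.
by split; [|exact: Hj|left].
Qed.

(** Both arcs are arcs of the word, the outer one possibly starting at a virtual position. It starts
    earlier, so its start has the larger key and is still waiting at [c'], against greediness. *)
Let no_nesting_pos a b c' d : arc a (Lpos d) -> arc (Lpos b) (Lpos c') ->
  lt_nn a (Lpos b) -> c' < d -> False.
Proof.
move=> ad bc ab cd; have wbc := arc_pos bc; have [] := wbc; rewrite ltn_add2l => bc' _ _.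
have bn := ltn_ord b.
have kc : k + c' < k + d by rewrite ltn_add2l.
case: a ab ad => [[[] a]|] ab ad.
- have [|xk wd _] := arc_switch ad; first by rewrite lt_nnE.
  apply: (gW (iN d) wbc wd _ kc); rewrite /nn_key; lia.
- have wad := arc_pos ad; move: ab; rewrite lt_nnE /= => ab.
  apply: (gW (iN d) wbc wad _ kc); rewrite /nn_key; lia.
- have [|xk wd _] := arc_switch ad; first by rewrite lt_nnE.
  apply: (gW (iN d) wbc wd _ kc); rewrite /nn_key; lia.
Qed.

Let first_mono := nn_first_mono Wc ck gW.

Let no_nesting_gt0 a b c' d : arc a (Lpos d) -> arc b c' ->
  lt_nn a b -> lt_nn c' (Lpos d) -> False.
Proof.
have [tauk tauK tauz tau_fix] := tauP.
move=> ad bc ab cd; have [lbc _ _] := bc.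
case: c' => [[[] c']|] in bc cd lbc *.
- case: b => [[[] b]|] in bc ab lbc *; rewrite ?lt_nnE // in lbc.
  case: a => [[[] a]|] in ad ab *; rewrite ?lt_nnE //= in ab.
  apply: (no_nesting_pos (arc_opp ad) (arc_opp bc)); first by rewrite lt_nnE.
  by [].
- case: (boolP (lt_nn None b)) => [b0|b0].
    case: b => [[[] b]|] in bc ab b0 lbc *; rewrite ?lt_nnE // in b0.
    by apply: (no_nesting_pos ad bc ab); rewrite lt_nnE in cd.
  have a0 : ~~ lt_nn None a.
    by move: b0 ab; rewrite !lt_nnE; case: (a) (b) => [[[] ?]|] [[[] ?]|].
  have [xk wx Ha] := arc_switch ad a0; have [yk wy Hb] := arc_switch bc b0.
  rewrite lt_nnE /= in cd.
  set x := W (k + d) in xk wx Ha; set y := W (k + c') in yk wy Hb.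
  (* Both arcs come from nonpositive elements. Their right ends are ordered as the letters; [nn_tau]
     reverses the letters other than the zero one, which orders the left ends against a nesting. *)
  have yx : y < x.
    case: (ltngtP y x) => // [xy|exy].
      have := first_mono xy yk (iN d) (iN c') wx wy; lia.
    case: wx => _ _ /(_ (k + c')); rewrite ltn_add2l -/x -/y; lia.
  case: Ha => [[a_0 _]|[i [aE tx wi]]].
    by move: ab b0; rewrite a_0 => ->.
  case: Hb => [[b_0 [ok yz]]|[j [bE ty wj]]].
    by move: yz; rewrite /nn_zero; lia.
  move: ab; rewrite aE bE lt_nnE /= => ji.
  have txy : nn_tau k x < nn_tau k y.
    by move: tx ty; rewrite /nn_tau; do 2 case: ifP => //; lia.
  by have := first_mono txy (tauk _ yk) (iN i) (iN j) wi wj; lia.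
- case: b => [[[] b]|] in bc ab lbc *; rewrite ?lt_nnE // in lbc.
  have [|zk] := arc_switch (arc_opp bc); first by rewrite lt_nnE.
  move=> wz [[_ [ok bz]]|[i []//]].
  case: a => [[[] a]|] in ad ab *; rewrite ?lt_nnE //= in ab.
  have [|xk wx] := arc_switch ad; first by rewrite lt_nnE.
  move=> [[]//|[i [[<-] tx wi]]].
  (* The inner arc ends at 0, so its opposite starts at 0 and belongs to the zero letter, the last
     one. The first real element of every other letter is therefore smaller, whereas nesting asks
     for a larger one. *)
  have txz : nn_tau k (W (k + d)) < W (k + b).
    by move: tx; rewrite bz /nn_zero /nn_tau; have := odd_double_half k; rewrite ok;
       case: ifP => //; lia.
  by have := first_mono txz zk (iN a) (iN b) wi wz; lia.
Qed.

Lemma nn_word_part :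
  nonnesting [set: Lambda n] (@lt_nn n) (word_part n k W (nn_tau k) (nn_zero k)).
Proof.
have [eqe _ _] := word_label_signed n W tauP.
have arcP s t : edge [set: Lambda n] (@lt_nn n) (word_part n k W (nn_tau k) (nn_zero k)) s t ->
    arc s t.
  move=> /edge_rel_part-/(_ eqe)[_ _ st /eqP lst H]; split=> // u lsu.
  by apply: H; rewrite ?inE //; apply/eqP.
move=> a b c' d ab bc cd [/arcP ad /arcP bc'].
case: (boolP (lt_nn None d)) => [|d0].
  case: d => [[[] d]|] in cd ad *; rewrite lt_nnE // => _.
  exact: no_nesting_gt0 ad bc' ab cd.
(* The outer arc ends at a nonpositive element; negating both arcs keeps the nesting and makes the
   new right end positive. *)
have [i aE] : exists i, Lopp a = Lpos i.
  move: ab bc cd d0; rewrite !lt_nnE.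
  by case: (a) (b) (c') (d) => [[[] i]|] [[[] ?]|] [[[] ?]|] [[[] ?]|] // *; exists i.
have := arc_opp ad; rewrite aE => ad'.
by apply: (no_nesting_gt0 ad' (arc_opp bc')); rewrite -?aE lt_nn_opp.
Qed.
End GreedyNonnesting.

(** * From partitions to words *)

Lemma real_position n k t : t < k + n -> k <= t -> exists i : 'I_n, t = k + i.
Proof. by move=> tN kt; have tn : t - k < n; [lia|exists (Ordinal tn) => /=; lia]. Qed.

Section PartitionWord.
Variables (n : nat) (e : rel (Lambda n)).
Hypothesis He : signed_equivalence e.

Lemma signed_refl s : e s s.
Proof. by case: He => eqe _ _; case: (eqe s s s). Qed.

Lemma signed_trans s t u : e s t -> e s u = e t u.
Proof. by case: He => eqe _ _; case: (eqe s t u) => _; apply. Qed.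

Lemma signed_sym s t : e s t = e t s.
Proof.
have H s' t' : e s' t' -> e t' s' by move=> st; rewrite -(signed_trans _ st) signed_refl.
by apply/idP/idP; apply: H.
Qed.

Lemma signed_transr s t u : e s t -> e u s = e u t.
Proof. by move=> st; rewrite !(signed_sym u) (signed_trans _ st). Qed.

Lemma signed_opp s t : e (Lopp s) (Lopp t) = e s t.
Proof.
case: He => _ eopp _; apply/idP/idP => [/eopp|/eopp //].
by rewrite !LoppK.
Qed.

Lemma signed_neg i j : e (Lneg i) (Lneg j) = e (Lpos i) (Lpos j).
Proof. exact: signed_opp (Lpos i) (Lpos j). Qed.

Lemma signed_pos_neg i j : e (Lpos i) (Lneg j) = e (Lpos j) (Lneg i).
Proof. by rewrite -(signed_opp (Lpos i)) signed_sym. Qed.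

Lemma signed_zero i : e (Lpos i) (Lneg i) = e (Lpos i) None.
Proof.
case: He => _ _ e0; apply/idP/idP => [/e0//|i0].
by rewrite (signed_trans _ i0) -(signed_opp None) /= signed_sym.
Qed.

Definition least_equiv i : 'I_n := [arg min_(j < i | e (Lpos i) (Lpos j)) j].

Lemma least_equivP i : e (Lpos i) (Lpos (least_equiv i)) /\
  forall j, e (Lpos i) (Lpos j) -> least_equiv i <= j.
Proof. by rewrite /least_equiv; case: arg_minnP => //; apply: signed_refl. Qed.

Lemma least_equiv_eq i j : (least_equiv i == least_equiv j) = e (Lpos i) (Lpos j).
Proof.
have [ei Hi] := least_equivP i; have [ej Hj] := least_equivP j.
apply/eqP/idP => [ij|ij].
  by rewrite (signed_trans _ ei) ij -(signed_trans _ ej) signed_refl.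
apply: val_inj; apply/eqP; rewrite eqn_leq Hi ?Hj //=.
  by rewrite -(signed_trans _ ij).
by rewrite (signed_trans _ ij).
Qed.

Lemma least_equivK i : least_equiv (least_equiv i) = least_equiv i.
Proof. by apply/eqP; rewrite eq_sym least_equiv_eq; case: (least_equivP i). Qed.

Definition switches i := [exists j, e (Lpos i) (Lneg j)].

Lemma switches_equiv i j : e (Lpos i) (Lpos j) -> switches i = switches j.
Proof. by move=> ij; apply: eq_existsb => u; rewrite (signed_trans _ ij). Qed.

Lemma switches_least i : switches (least_equiv i) = switches i.
Proof. by apply/esym/switches_equiv; case: (least_equivP i). Qed.

Definition switch_mins := [set r | (least_equiv r == r) && switches r].

Local Notation S := switch_mins.
Local Notation k := #|switch_mins|.

Lemma least_switch i : switches i -> least_equiv i \in S.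
Proof. by move=> si; rewrite inE least_equivK eqxx switches_least. Qed.

Definition switch_rank (r : 'I_n) := #|[set s in S | s < r]|.

Lemma switch_rank_mono (r r' : 'I_n) : r \in S -> r < r' -> switch_rank r < switch_rank r'.
Proof.
move=> rS rr'; apply: proper_card; apply/properP; split.
  by apply/fintype.subsetP => s; rewrite !inE => /andP[-> sr]; apply: ltn_trans rr'.
by exists r; rewrite inE rS // ltnn.
Qed.

Lemma switch_rank_lt r : r \in S -> switch_rank r < k.
Proof.
move=> rS; apply: proper_card; apply/properP; split.
  by apply/fintype.subsetP => s; rewrite inE => /andP[].
by exists r; rewrite // inE rS ltnn.
Qed.

Lemma switch_rank_inj : {in S &, injective switch_rank}.
Proof.
move=> r r' rS rS' e'; apply: val_inj; case: (ltngtP r r') => // rr'.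
  by have := switch_rank_mono rS rr'; rewrite e' ltnn.
by have := switch_rank_mono rS' rr'; rewrite e' ltnn.
Qed.

Lemma switch_rank_surj j : j < k -> exists2 r, r \in S & switch_rank r = j.
Proof.
move=> jk.
pose f r : 'I_k := insubd (Ordinal jk) (switch_rank r).
have fE r : r \in S -> f r = switch_rank r :> nat.
  by move=> rS; rewrite val_insubd switch_rank_lt.
have finj : {in S &, injective f}.
  by move=> r r' rS rS' /(congr1 val); rewrite /= !fE //; apply: switch_rank_inj.
have /eqP fS : f @: S == [set: 'I_k].
  by rewrite eqEcard finset.subsetT cardsT card_ord (card_in_imset finj) leqnn.
have : Ordinal jk \in f @: S by rewrite fS finset.in_setT.
by move=> /imsetP[r rS jr]; exists r => //; rewrite -fE // -jr.
Qed.

(** For switching [i], the least positive element of the opposite block; the default [i] is reached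
    only if the block of [i] does not switch. *)
Definition opposite_min i := least_equiv (odflt i [pick j | e (Lpos i) (Lneg j)]).

Lemma opposite_minP i : switches i -> e (Lpos i) (Lneg (opposite_min i)).
Proof.
rewrite /opposite_min => /existsP[j ij]; case: pickP => [u iu|/(_ j)]; last by rewrite ij.
by rewrite (signed_trans _ iu) signed_neg; case: (least_equivP u).
Qed.

Lemma opposite_min_least i : least_equiv (opposite_min i) = opposite_min i.
Proof. exact: least_equivK. Qed.

Lemma opposite_min_eq i j : switches i ->
  e (Lpos i) (Lneg j) = (least_equiv j == opposite_min i).
Proof.
move=> si; rewrite -opposite_min_least least_equiv_eq -signed_neg.
by rewrite (signed_trans _ (opposite_minP si)) signed_sym.
Qed.

Lemma switch_minsP r : r \in S -> least_equiv r = r /\ switches r.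
Proof. by rewrite inE => /andP[/eqP]. Qed.

Lemma opposite_min_mem i : switches i -> opposite_min i \in S.
Proof.
move=> si; rewrite inE opposite_min_least eqxx; apply/existsP; exists i.
by rewrite signed_pos_neg; apply: opposite_minP.
Qed.

Lemma opposite_minK r : r \in S -> opposite_min (opposite_min r) = r.
Proof.
move=> /switch_minsP[lr sr]; have /switch_minsP[_ so] := opposite_min_mem sr.
apply/esym/eqP; rewrite -{1}lr -opposite_min_eq // signed_pos_neg.
exact: opposite_minP.
Qed.

Lemma opposite_min_fix r : r \in S -> (opposite_min r == r) = e (Lpos r) None.
Proof.
move=> rS; have [lr sr] := switch_minsP rS.
by rewrite -signed_zero opposite_min_eq // lr eq_sym.
Qed.

Lemma zero_switches i : e (Lpos i) None -> switches i.
Proof. by rewrite -signed_zero => i0; apply/existsP; exists i. Qed.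

Lemma zero_least i j : e (Lpos i) None -> e (Lpos j) None -> least_equiv i = least_equiv j.
Proof.
by move=> i0 j0; apply/eqP; rewrite least_equiv_eq (signed_trans _ i0) signed_sym.
Qed.

Lemma zero_least_self i : e (Lpos i) None -> e (Lpos (least_equiv i)) None.
Proof. by move=> i0; rewrite -(@signed_trans (Lpos i)) //; case: (least_equivP i). Qed.

Lemma card_fixed_min :
  #|[set r in S | opposite_min r == r]| = [exists i, e (Lpos i) None].
Proof.
case: existsP => [[i i0]|n0].
  have -> : [set r in S | opposite_min r == r] = [set least_equiv i]; last by rewrite cards1.
  apply/setP => r; rewrite finset.in_set finset.in_set1; apply/andP/eqP => [[rS]|->].
    rewrite opposite_min_fix // => r0; have [<- _] := switch_minsP rS.
    exact: zero_least.
  have li := least_switch (zero_switches i0).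
  by rewrite opposite_min_fix // zero_least_self.
apply/eqP; rewrite cards_eq0 -finset.subset0; apply/fintype.subsetP => r.
rewrite finset.in_set => /andP[rS]; rewrite opposite_min_fix // => r0.
by case: n0; exists r.
Qed.

(** The involution [opposite_min] exchanges the elements below their image with those above it; its
    only possible fixed point comes from the zero block. *)
Lemma card_switch_mins :
  k = #|[set r in S | r < opposite_min r]|.*2 + [exists i, e (Lpos i) None].
Proof.
have -> : [exists i, e (Lpos i) None] = #|[set r in S | opposite_min r == r]| :> nat.
  exact/esym/card_fixed_min.
have -> : #|[set r in S | r < opposite_min r]|.*2 =
    #|[set r in S | r < opposite_min r]| + #|[set r in S | opposite_min r < r]|.
  rewrite -addnn; congr (_ + _).
  rewrite -(@card_in_imset _ _ opposite_min).
    apply: eq_card => r; apply/imsetP/idP => [[u]|].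
      move=> /setIdP[uS uo] ->.
      by rewrite finset.in_set opposite_min_mem ?opposite_minK //; case: (switch_minsP uS).
    rewrite finset.in_set => /andP[rS ro]; exists (opposite_min r); last by rewrite opposite_minK.
    by rewrite finset.in_set opposite_min_mem ?opposite_minK //; case: (switch_minsP rS).
  move=> x y /setIdP[xS _] /setIdP[yS _] xy.
  by have := congr1 opposite_min xy; rewrite !opposite_minK.
rewrite -!sum1_card (bigID (fun r : 'I_n => r < opposite_min r)) /= -addnA; congr (_ + _).
  by apply: eq_bigl => r; rewrite [RHS]finset.in_set.
rewrite (bigID (fun r : 'I_n => opposite_min r < r)) /=; congr (_ + _).
  by apply: eq_bigl => r; rewrite [RHS]finset.in_set -andbA; congr (_ && _); lia.
apply: eq_bigl => r; rewrite [RHS]finset.in_set -andbA; congr (_ && _).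
by rewrite -val_eqE /=; lia.
Qed.

Lemma odd_switch_mins : odd k = [exists i, e (Lpos i) None].
Proof. by rewrite card_switch_mins oddD odd_double; case: existsP. Qed.

(* On a stable set of switching blocks whose order negation reverses, negation
   acts on ranks as the reversal. *)
Lemma rank_opposite (A : {set 'I_n}) : A \subset S ->
  (forall r, r \in A -> opposite_min r \in A) ->
  {in A &, forall r s : 'I_n, r < s -> opposite_min s < opposite_min r} ->
  forall r, r \in A ->
  #|[set s in A | s < opposite_min r]| + #|[set s in A | s < r]| + 1 = #|A|.
Proof.
move=> /fintype.subsetP AS Ao dec r rA.
have -> : #|[set s in A | s < opposite_min r]| = #|[set s in A | r < s]|.
  rewrite -[RHS](@card_in_imset _ _ opposite_min).
    apply: eq_card => u; apply/idP/imsetP => [|[v]].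
      rewrite finset.in_set => /andP[uA ur]; exists (opposite_min u); last first.
        by rewrite opposite_minK ?AS.
      by rewrite finset.in_set Ao //= -{1}(opposite_minK (AS _ rA)); apply: dec; rewrite ?Ao.
    by rewrite !finset.in_set => /andP[vA rv] ->; rewrite Ao //=; apply: dec.
  move=> x y; rewrite !finset.in_set => /andP[xA _] /andP[yA _] xy.
  by have := congr1 opposite_min xy; rewrite !opposite_minK ?AS.
rewrite -!sum1_card [RHS](bigID (fun s : 'I_n => r < s)) /= -addnA; congr addn.
  by apply: eq_bigl => s; rewrite finset.in_set.
rewrite [RHS](bigID (fun s : 'I_n => s < r)) /=; congr addn.
  by apply: eq_bigl => s; rewrite finset.in_set -andbA; congr (_ && _); lia.
rewrite (big_pred1 r) // => s; rewrite /= -andbA.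
apply/and3P/eqP => [[_ rs sr]|->]; last by rewrite rA ltnn.
by apply: val_inj; apply/eqP; rewrite eqn_leq (leqNgt s) (leqNgt r) rs sr.
Qed.

(** With ranks as letters of the switching blocks, the least position of such a block is its virtual
    one. The value [0] is taken only at positions from [k + n] on. *)
Definition part_word t :=
  if t < k then t else
  if insub (t - k) is Some i then
    if switches i then switch_rank (least_equiv i) else k + least_equiv i
  else 0.

Lemma part_word_pos (i : 'I_n) :
  part_word (k + i) = if switches i then switch_rank (least_equiv i) else k + least_equiv i.
Proof.
rewrite /part_word ltnNge leq_addr /= addKn.
by case: insubP => [u _ /val_inj -> //|]; rewrite ltn_ord.
Qed.

Lemma part_word_virtual j : j < k -> part_word j = j.
Proof. by rewrite /part_word => ->. Qed.

Lemma part_word_lt (i : 'I_n) : (part_word (k + i) < k) = switches i.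
Proof.
rewrite part_word_pos; case: ifP => si; first by rewrite switch_rank_lt ?least_switch.
by rewrite ltnNge leq_addr.
Qed.

Lemma part_word_eq (i j : 'I_n) :
  (part_word (k + i) == part_word (k + j)) = e (Lpos i) (Lpos j).
Proof.
apply/eqP/idP => [|ij].
  have := part_word_lt i; have := part_word_lt j; rewrite !part_word_pos => + + eij.
  move: eij; case: ifP => si; case: ifP => sj; rewrite ?ltnNge ?leq_addr //.
  - by move=> /switch_rank_inj eij _ _; rewrite -least_equiv_eq eij ?least_switch.
  - by move=> ->; rewrite leq_addr.
  - by move=> <-; rewrite leq_addr.
  - by move=> /addnI/val_inj eij _ _; rewrite -least_equiv_eq eij.
rewrite !part_word_pos (switches_equiv ij).
by rewrite (eqP (_ : least_equiv i == least_equiv j)) ?least_equiv_eq.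
Qed.

Lemma part_word_block : block_word (k + n) (cnt part_word (k + n)) part_word.
Proof.
split=> [t tN|//|t tN].
  case: (ltnP t k) => [/part_word_virtual -> //|kt].
  have [i ->] := real_position tN kt; case: (boolP (switches i)) => si.
    by rewrite ltnW // (leq_trans _ (leq_addr _ _)) // part_word_lt.
  rewrite part_word_pos (negbTE si) leq_add2l.
  by case: (least_equivP i) => _; apply; apply: signed_refl.
case: (ltnP t k) => [/part_word_virtual -> //|kt ct].
have [|u [_ uN Wu]] := @cnt_occ part_word 0 (k + n) t; first by rewrite {1}/cnt big_ord0.
case: (ltnP u k) => uk.
  by move: Wu; rewrite part_word_virtual //; lia.
have [i uE] := real_position uN uk; have := part_word_lt i.
rewrite -uE Wu ltnNge kt => /esym/negbT/negbTE si.
move: Wu; rewrite uE part_word_pos si => <-.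
by rewrite part_word_pos switches_least si least_equivK.
Qed.

Lemma part_word_cnt j : j < k -> 1 < cnt part_word (k + n) j.
Proof.
move=> jk; have [r rS rj] := switch_rank_surj jk.
have [lr sr] := switch_minsP rS.
have Wr : part_word (k + r) = j by rewrite part_word_pos sr lr.
have rN : (k + r).+1 <= k + n by rewrite -addnS leq_add2l.
apply: leq_trans (leq_cnt _ _ rN); rewrite cntS Wr eqxx addn1 ltnS.
by apply: (@cnt_gt0 _ j); [lia|apply: part_word_virtual].
Qed.

Section Label.
Variables (tau : nat -> nat) (z : nat).
Hypothesis tauP : zero_involution k tau z.
Hypothesis tau_rank : forall r, r \in S -> switch_rank (opposite_min r) = tau (switch_rank r).
Hypothesis zero_rank : forall i, e (Lpos i) None -> switch_rank (least_equiv i) = z.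

(** On positive elements this is [part_word_eq]. Any other element is equivalent to a positive one
    with the same label, except the negatives of nonswitching elements and a zero element whose
    block has no positive element; these are compared directly. *)
Lemma part_word_label s t :
  e s t = (word_label k part_word tau z s == word_label k part_word tau z t).
Proof.
set lab := word_label k part_word tau z.
have labE i : lab (Lpos i) = Some (false, part_word (k + i)).
  by rewrite /lab /word_label /=; case: ifP.
have lab_neg i : switches i -> lab (Lneg i) = lab (Lpos (opposite_min i)).
  move=> si; rewrite labE /lab /word_label /= part_word_lt si !part_word_pos si.
  have so : opposite_min i \in S by apply: opposite_min_mem.
  have [-> ->] := switch_minsP so.
  rewrite -tau_rank ?least_switch //; congr (Some (false, switch_rank _)).
  apply/eqP; rewrite -opposite_min_least -(opposite_min_least i) least_equiv_eq -signed_neg.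
  have [il _] := least_equivP i.
  rewrite -(@signed_trans (Lpos i)); first exact: opposite_minP.
  by rewrite (signed_trans _ il); apply: opposite_minP; rewrite switches_least.
have canon u : (exists2 i, e u (Lpos i) & lab u = lab (Lpos i)) \/
    ((exists2 i, u = Lneg i & ~~ switches i) \/ (u = None /\ ~~ odd k)).
  case: u => [[[] i]|].
  - case: (boolP (switches i)) => si; last by right; left; exists i.
    left; exists (opposite_min i); last exact: lab_neg.
    by rewrite signed_sym signed_pos_neg; apply: opposite_minP.
  - by left; exists i => //; apply: signed_refl.
  case: (boolP (odd k)) => ok; last by right; right.
  have := ok; rewrite odd_switch_mins => /existsP[i i0].
  left; exists i; first by rewrite signed_sym.
  rewrite labE part_word_pos zero_switches // zero_rank //.
  by rewrite /lab /word_label ok.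
have lab_nsw i : ~~ switches i -> lab (Lneg i) = Some (true, part_word (k + i)).
  by move=> si; rewrite /lab /word_label /= part_word_lt (negbTE si).
have lab_none : ~~ odd k -> lab None = None.
  by move=> ok; rewrite /lab /word_label (negbTE ok).
have pos_nsw i j : ~~ switches j -> e (Lpos i) (Lneg j) = false.
  by move=> /existsPn/(_ i)/negbTE; rewrite signed_pos_neg.
have none_false i : ~~ odd k -> e (Lpos i) None = false.
  by rewrite odd_switch_mins => /existsPn/(_ i)/negbTE.
have none_neg i : ~~ odd k -> e (Lneg i) None = false.
  by move=> ok; rewrite -(signed_opp (Lneg i)) none_false.
have [[i si ->]|[[i -> ni]|[-> ok]]] := canon s; have [[j tj ->]|[[j -> nj]|[-> ok']]] := canon t.
- by rewrite (signed_trans _ si) (signed_transr _ tj) !labE -part_word_eq; apply/eqP/eqP=> [->|[]].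
- by rewrite (signed_trans _ si) pos_nsw // labE lab_nsw.
- by rewrite (signed_trans _ si) none_false // labE lab_none.
- by rewrite (signed_transr _ tj) signed_sym pos_nsw // labE lab_nsw.
- by rewrite signed_neg !lab_nsw // -part_word_eq; apply/eqP/eqP=> [->|[]].
- by rewrite none_neg // lab_nsw // lab_none.
- by rewrite (signed_transr _ tj) signed_sym none_false // labE lab_none.
- by rewrite signed_sym none_neg // lab_nsw // lab_none.
- by rewrite signed_refl eqxx.
Qed.
End Label.
End PartitionWord.

(** * The word of a noncrossing partition *)

Section NoncrossingWord.
Variables (n : nat) (e : rel (Lambda n)).
Hypothesis He : signed_equivalence e.
Hypothesis nc : noncrossing [set~ (None : Lambda n)] (@lt_nc n) (rel_part e).

Local Notation S := (switch_mins e).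
Local Notation k := #|switch_mins e|.

Lemma noncrossing_blocks a b c d : lt_nc a b -> lt_nc b c -> lt_nc c d ->
  e a c -> e b d -> e a b.
Proof.
have lt_some (s t : Lambda n) : lt_nc s t -> (s : bool) /\ (t : bool).
  by case: s t => [[? ?]|] [[? ?]|].
move=> ab bc cd; have [ha hb] := lt_some _ _ ab; have [hc hd] := lt_some _ _ cd.
case: a b c d ha hb hc hd ab bc cd => [a|] [b|] [c|] [d|] // _ _ _ _.
pose key (x : bool * 'I_n) := if x.1 then x.2 : nat else n + x.2.
have ltE x y : lt_nc (Some x) (Some y) = (key x < key y).
  case: x y => [[] x] [[] y] //=; rewrite /key /=; have := ltn_ord x; have := ltn_ord y; lia.
have kinj : injective key.
  move=> [bx x] [by_ y]; rewrite /key /=.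
  have := ltn_ord x; have := ltn_ord y.
  case: bx by_ => [] [] /= ? ? ?; try lia; congr (_, _); apply: val_inj; rewrite /=; lia.
pose lab (x : bool * 'I_n) := [set t | e (Some x) t].
have labE x y : lab x = lab y <-> e (Some x) (Some y).
  split=> [/setP/(_ (Some y))|xy]; first by rewrite !inE signed_refl.
  by apply/setP => t; rewrite !inE (signed_trans He _ xy).
rewrite !ltE => ab bc cd /labE ac /labE bd.
apply/negPn/negP => nab.
have [|a' [b' [c' [d' [ab' bc' cd' eac ebd]]]]] :=
  crossing_consecutive kinj ab bc cd ac bd.
  by move=> /labE; apply/negP.
have edgeP x y : consecutive key lab x y ->
    edge [set~ None] (@lt_nc n) (rel_part e) (Some x) (Some y).
  move=> [xy lxy H]; apply/edge_rel_part; first by case: He.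
  split; rewrite ?inE ?ltE //; first exact/labE.
  case=> [u|]; last by rewrite !inE.
  by move=> /labE xu _; rewrite !ltE; apply: H.
by apply: (nc _ _ _ (conj (edgeP _ _ eac) (edgeP _ _ ebd))); rewrite ltE.
Qed.

(** The blocks of [r] and [s] contain the opposites of their [opposite_min]. Negative elements are
    ordered by absolute value, so if these minima increased, the two blocks would cross. *)
Lemma noncrossing_opposite : {in S &, forall r s : 'I_n, r < s ->
  opposite_min e s < opposite_min e r}.
Proof.
move=> r s rS sS rs; have [lr sr] := switch_minsP rS; have [ls ss] := switch_minsP sS.
have nrs : ~~ e (Lpos r) (Lpos s).
  by rewrite -least_equiv_eq // lr ls; apply/eqP => rs'; move: rs; rewrite rs' ltnn.
have rr := opposite_minP He sr; have ss' := opposite_minP He ss.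
have nopp : ~~ e (Lneg (opposite_min e r)) (Lneg (opposite_min e s)).
  by rewrite -(signed_trans He _ rr) -(signed_transr He _ ss').
case: (ltngtP (opposite_min e s) (opposite_min e r)) => // [sr'|/val_inj sr'].
  case/negP: nopp; apply: (@noncrossing_blocks _ _ (Lpos r) (Lpos s)) => //.
    by rewrite signed_sym.
  by rewrite signed_sym.
by move: nopp; rewrite sr' signed_refl.
Qed.

Lemma noncrossing_rank r : r \in S ->
  switch_rank e (opposite_min e r) = nc_tau k (switch_rank e r).
Proof.
move=> rS; have := rank_opposite He (subxx S) _ noncrossing_opposite rS.
rewrite -/(switch_rank _ _) -/(switch_rank e r) /nc_tau => H.
rewrite -H; last by move=> u uS; apply: opposite_min_mem; case: (switch_minsP uS).
lia.
Qed.

Lemma noncrossing_zero i : e (Lpos i) None ->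
  switch_rank e (least_equiv e i) = nc_zero k.
Proof.
move=> i0; have rS := least_switch He (zero_switches He i0).
have := noncrossing_rank rS; have := switch_rank_lt rS.
have := odd_double_half k; rewrite /nc_tau /nc_zero odd_switch_mins //.
have -> : [exists i, e (Lpos i) None] by apply/existsP; exists i.
have /eqP -> : opposite_min e (least_equiv e i) == least_equiv e i.
  by rewrite opposite_min_fix // zero_least_self.
lia.
Qed.

Lemma noncrossing_greedy : greedy (nc_key k) (k + n) (part_word e).
Proof.
(* A virtual position is represented by a negative element of its block. By [noncrossing_opposite]
   these representatives decrease as the letter grows, in agreement with [nc_key]. *)
have virt p : p < k -> exists r, [/\ r \in S, switch_rank e r = p &
    forall j, e (Lneg (opposite_min e r)) (Lpos j) = (part_word e (k + j) == p)].
  move=> pk; have [r rS rp] := switch_rank_surj pk; exists r; split=> // j.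
  have [lr sr] := switch_minsP rS.
  rewrite -(signed_trans He _ (opposite_minP He sr)) -part_word_eq //.
  by rewrite part_word_pos sr lr rp eq_sym.
have keyR u : k <= u -> nc_key k u = u by rewrite /nc_key ltnNge => ->.
have real x t : wedge (part_word e) x t -> k <= t.
  move=> [xt Wx _]; rewrite leqNgt; apply/negP => tk.
  by move: Wx; rewrite !part_word_virtual //; lia.
move=> x t y d dN wx wy yt td kxy.
have tN : t < k + n by lia.
have [it tE] := real_position tN (real _ _ wx).
have [jd dE] := real_position dN (real _ _ wy).
have [xt Wx nWx] := wx; have [yd Wy _] := wy; subst t d.
rewrite ltn_add2l in td.
(* After this replacement [x], [y], [t], [d] form a crossing, so [x] and [y] lie in one block. This
   contradicts the distinctness of virtual blocks if both are virtual, and the wedge from [x] to [t]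
   if [y] is real; the keys exclude the remaining case. *)
case: (ltnP y k) => ky; case: (ltnP x k) => kx.
- have [r [rS rx re]] := virt _ kx; have [s [sS sy se]] := virt _ ky.
  have sr : s < r.
    have yx : y < x by move: kxy; rewrite /nc_key kx ky; lia.
    case: (ltngtP s r) => // [rs|/val_inj srE].
      by have := switch_rank_mono rS rs; lia.
    by move: yx; rewrite -rx -sy srE ltnn.
  have os := noncrossing_opposite sS rS sr.
  have : e (Lneg (opposite_min e r)) (Lneg (opposite_min e s)).
    apply: (@noncrossing_blocks _ _ (Lpos it) (Lpos jd)) => //.
      by rewrite re -Wx part_word_virtual.
    by rewrite se -Wy part_word_virtual.
  rewrite signed_neg // -least_equiv_eq // !opposite_min_least // => /eqP ors.
  by move: os; rewrite ors ltnn.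
- move: kxy; rewrite (keyR x) // /nc_key ky; lia.
- have [r [rS rx re]] := virt _ kx.
  have yN : y < k + n by lia.
  have [iy yE] := real_position yN ky; subst y; rewrite ltn_add2l in yt.
  have : e (Lneg (opposite_min e r)) (Lpos iy).
    apply: (@noncrossing_blocks _ _ (Lpos it) (Lpos jd)) => //.
      by rewrite re -Wx part_word_virtual.
    by rewrite -part_word_eq // Wy.
  rewrite re => /eqP Wi; apply: (nWx (k + iy)); [lia|by rewrite ltn_add2l|].
  by rewrite Wi -Wx part_word_virtual.
- have yN : y < k + n by lia.
  have xN : x < k + n by lia.
  have [iy yE] := real_position yN ky; subst y; rewrite ltn_add2l in yt.
  have [ix xE] := real_position xN kx; subst x; rewrite ltn_add2l in xt.
  rewrite !keyR // ltn_add2l in kxy.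
  have : e (Lpos ix) (Lpos iy).
    apply: (@noncrossing_blocks _ _ (Lpos it) (Lpos jd)) => //.
      by rewrite -part_word_eq // Wx.
    by rewrite -part_word_eq // Wy.
  rewrite -part_word_eq // => /eqP Wi.
  by apply: (nWx (k + iy)); rewrite ?ltn_add2l // -Wi.
Qed.
End NoncrossingWord.

(** * The word of a nonnesting partition *)

Section NonnestingWord.
Variables (n : nat) (e : rel (Lambda n)).
Hypothesis He : signed_equivalence e.
Hypothesis nn : nonnesting [set: Lambda n] (@lt_nn n) (rel_part e).

Local Notation S := (switch_mins e).
Local Notation k := #|switch_mins e|.
Local Notation opp := (opposite_min e).

Let arc s t := [/\ lt_nn s t, e s t & forall u, e s u -> ~~ (lt_nn s u && lt_nn u t)].

Let no_nesting a b c d : lt_nn a b -> lt_nn b c -> lt_nn c d -> arc a d -> arc b c -> False.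
Proof.
have edgeP s t : arc s t -> edge [set: Lambda n] (@lt_nn n) (rel_part e) s t.
  move=> [st est H]; apply/edge_rel_part; first by case: He.
  by split=> //; rewrite ?inE // => u eu _; apply: H.
by move=> ab bc cd /edgeP ad /edgeP bc'; apply: (nn ab bc cd).
Qed.

Let min_le r (j : 'I_n) : r \in S -> e (Lpos r) (Lpos j) -> r <= j.
Proof.
move=> rS rj; have [lr _] := switch_minsP rS; have [_ H] := least_equivP He r.
by have := H _ rj; rewrite lr.
Qed.

Let opp_e r : r \in S -> e (Lpos r) (Lneg (opp r)).
Proof. by move=> /switch_minsP[_ /(opposite_minP He)]. Qed.

Let oppS r : r \in S -> opp r \in S.
Proof. by move=> /switch_minsP[_]; apply: opposite_min_mem. Qed.

Let opp_arc r : r \in S -> opp r != r -> arc (Lneg (opp r)) (Lpos r).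
Proof.
move=> rS nr; split; first by rewrite lt_nnE.
  by rewrite signed_sym // opp_e.
move=> u; rewrite -(signed_trans He _ (opp_e rS)) => ru.
apply/negP; rewrite !lt_nnE; case: u ru => [[[] j]|] /=.
- rewrite (signed_trans He _ (opp_e rS)) (signed_neg He) andbT => oj.
  by have := min_le (oppS rS) oj; rewrite leqNgt => /negP.
- by move=> /(min_le rS); rewrite leqNgt => /negP.
- by rewrite -opposite_min_fix // (negbTE nr).
Qed.

Let zero_arc r : r \in S -> opp r == r -> arc None (Lpos r).
Proof.
move=> rS; rewrite opposite_min_fix // => r0; split; first by rewrite lt_nnE.
  by rewrite signed_sym.
move=> u; rewrite -(signed_trans He _ r0) => ru.
apply/negP; rewrite !lt_nnE; case: u ru => [[[] j]|] //= /(min_le rS).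
by rewrite leqNgt => /negP.
Qed.

(** If another switching block had a larger least positive element [s], its arc ending at [s] would
    contain the arc from 0 to [r]. *)
Let zero_max r (s : 'I_n) : r \in S -> opp r == r -> s \in S -> s <= r.
Proof.
move=> rS rr sS; rewrite leqNgt; apply/negP => rs.
have [ss|ns] := boolP (opp s == s).
  have : least_equiv e r = least_equiv e s.
    by apply: zero_least; rewrite // -opposite_min_fix.
  have [-> _] := switch_minsP rS; have [-> _] := switch_minsP sS => rsE.
  by move: rs; rewrite rsE ltnn.
by apply: (no_nesting _ _ _ (opp_arc sS ns) (zero_arc rS rr)); rewrite lt_nnE.
Qed.

Let S0 := [set r in S | opp r != r].

Let S0P r : (r \in S0) = (r \in S) && (opp r != r).
Proof. exact: finset.in_set. Qed.

(** Otherwise the arc from minus [opp s] to [s] would contain the one from minus [opp r] to [r]. *)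
Let opp_dec : {in S0 &, forall r s : 'I_n, r < s -> opp s < opp r}.
Proof.
move=> r s; rewrite !S0P => /andP[rS nr] /andP[sS ns] rs.
case: (ltngtP (opp s) (opp r)) => // [rs'|/val_inj e'].
  have H1 : lt_nn (Lneg (opp s)) (Lneg (opp r)) by rewrite lt_nnE.
  have H2 : lt_nn (Lpos r) (Lpos s) by rewrite lt_nnE.
  by case: (no_nesting H1 _ H2 (opp_arc sS ns) (opp_arc rS nr)); rewrite lt_nnE.
by move: rs; rewrite -(opposite_minK He rS) -e' opposite_minK // ltnn.
Qed.

Let card_S0 : #|S0| = k./2.*2.
Proof.
have : #|S0| + odd k = k.
  rewrite odd_switch_mins // -[nat_of_bool _](card_fixed_min He).
  rewrite -[k in RHS](cardsID [set r | opp r == r]) addnC; congr addn.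
    by apply: eq_card => r; rewrite finset.in_setI [in RHS]finset.in_set finset.in_set.
  by apply: eq_card => r; rewrite S0P finset.in_setD andbC !finset.in_set.
by have := odd_double_half k; lia.
Qed.

(** The zero block comes last, so removing it changes no other rank. *)
Let rank_S0 r : r \in S0 -> #|[set s in S0 | s < r]| = switch_rank e r.
Proof.
rewrite S0P => /andP[rS nr]; apply: eq_card => s.
apply/setIdP/setIdP => [[]|[sS sr]]; first by rewrite S0P => /andP[].
rewrite S0P sS; split=> //; apply/negP => ss.
by have := zero_max sS ss rS; rewrite leqNgt sr.
Qed.

Let zero_rank r : r \in S -> opp r == r -> switch_rank e r = k.-1 /\ odd k.
Proof.
move=> rS rr; split; last first.
  by rewrite odd_switch_mins //; apply/existsP; exists r; rewrite -opposite_min_fix.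
rewrite /switch_rank (cardsD1 r S) rS add1n /=; apply: eq_card => s.
apply/setIdP/setD1P => [[sS sr]|[nsr sS]]; split=> //.
  by apply/eqP => srE; move: sr; rewrite srE ltnn.
by rewrite ltn_neqAle val_eqE nsr zero_max.
Qed.

Lemma nonnesting_rank r : r \in S ->
  switch_rank e (opp r) = nn_tau k (switch_rank e r).
Proof.
move=> rS; have := odd_double_half k; have := switch_rank_lt rS.
have [rr|nr] := boolP (opp r == r).
  by rewrite (eqP rr) /nn_tau; have [-> ->] := zero_rank rS rr; case: ifP; lia.
have oS : opp r \in S0.
  by rewrite S0P oppS // opposite_minK // eq_sym.
have rS0 : r \in S0 by rewrite S0P rS.
have sub : S0 \subset S by apply/fintype.subsetP => s; rewrite S0P => /andP[].
have stab s : s \in S0 -> opp s \in S0.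
  by rewrite !S0P => /andP[sS ns]; rewrite oppS // opposite_minK // eq_sym.
have := rank_opposite He sub stab opp_dec rS0.
rewrite !rank_S0 // card_S0 /nn_tau; case: ifP; lia.
Qed.

Lemma nonnesting_zero i : e (Lpos i) None ->
  switch_rank e (least_equiv e i) = nn_zero k.
Proof.
move=> i0; have rS := least_switch He (zero_switches He i0).
by case: (zero_rank rS) => //; rewrite opposite_min_fix // zero_least_self.
Qed.

(** The element for which a position stands: for a virtual position, the greatest nonpositive
    element of its block. *)
Let rep x s := (exists2 i : 'I_n, x = k + i & s = Lpos i) \/
  (exists r, [/\ r \in S, switch_rank e r = x & s = if opp r == r then None else Lneg (opp r)]).

Let rep_mono x y s t : rep x s -> rep y t -> x < y -> lt_nn s t.
Proof.
move=> [[i -> ->]|[r [rS rx ->]]] [[j -> ->]|[r' [rS' ry ->]]].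
- by rewrite ltn_add2l lt_nnE.
- by have := switch_rank_lt rS'; lia.
- by rewrite lt_nnE; case: ifP.
move=> xy; have rr' : r < r'.
  case: (ltngtP r r') => // [rr|/val_inj rE].
    by have := switch_rank_mono rS' rr; lia.
  by move: xy; rewrite -rx -ry rE ltnn.
have nr : opp r != r.
  by apply/negP => rr; have := zero_max rS rr rS'; rewrite leqNgt rr'.
rewrite (negbTE nr); case: ifPn => nr'; rewrite lt_nnE //.
by apply: opp_dec; rewrite // S0P ?rS ?rS'.
Qed.

Let wedge_arc x t : t < k + n -> wedge (part_word e) x t ->
  exists s (j : 'I_n), [/\ t = k + j, rep x s & arc s (Lpos j)].
Proof.
move=> tN [xt Wx nW].
have kt : k <= t.
  rewrite leqNgt; apply/negP => tk.
  by move: Wx; rewrite !part_word_virtual //; lia.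
have [j tE] := real_position tN kt; subst t.
case: (ltnP x k) => kx.
  have [r rS rx] := switch_rank_surj kx; have [lr sr] := switch_minsP rS.
  have Wr : part_word e (k + r) = x by rewrite part_word_pos sr lr.
  have rj : r = j.
    have rj : e (Lpos r) (Lpos j) by rewrite -part_word_eq // Wr -Wx part_word_virtual.
    have := min_le rS rj; rewrite leq_eqVlt => /orP[/eqP/val_inj//|rj'].
    case: (nW (k + r)); rewrite ?ltn_add2l //; first by lia.
    by rewrite Wr -Wx part_word_virtual.
  subst j; have [rr|nr] := boolP (opp r == r).
    exists None, r; split=> //; last exact: zero_arc.
    by right; exists r; rewrite rr.
  exists (Lneg (opp r)), r; split=> //; last exact: opp_arc.
  by right; exists r; rewrite (negbTE nr).
have xN : x < k + n by lia.
have [i xE] := real_position xN kx; subst x; rewrite ltn_add2l in xt.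
exists (Lpos i), j; split=> //; first by left; exists i.
split; [by rewrite lt_nnE|by rewrite -part_word_eq // Wx|].
move=> u iu; apply/negP; rewrite !lt_nnE; case: u iu => [[[] u]|] //= iu /andP[ui uj].
apply: (nW (k + u)); rewrite ?ltn_add2l // -Wx; apply/eqP.
by rewrite part_word_eq // signed_sym.
Qed.

(** A violation of the queue discipline is a pair of nested wedges; [wedge_arc] and [rep_mono] turn
    it into nested arcs of the diagram. *)
Lemma nonnesting_greedy : greedy (nn_key (k + n)) (k + n) (part_word e).
Proof.
move=> x t y d dN wx wy yt td; rewrite /nn_key => xy.
have tN : t < k + n by lia.
have [s [j [tE sx sj]]] := wedge_arc tN wx.
have [s' [j' [dE sy sj']]] := wedge_arc dN wy.
subst t d; rewrite ltn_add2l in td.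
have s's : lt_nn s' s by apply: rep_mono sy sx _; lia.
by apply: (no_nesting s's _ _ sj' sj); [case: sj|rewrite lt_nnE].
Qed.
End NonnestingWord.

(** * Types and the permutation [sigma_B] *)

Section Types.
Variables (R : realType) (n : nat).
Implicit Types (L : {vspace 'rV[R]_n}) (p : 'S_n).

Definition Lperm p (s : Lambda n) : Lambda n := if s is Some (b, i) then Some (b, p i) else None.

Let unsigned p : {linear 'rV[R]_n -> 'rV[R]_n} := signed_perm p [ffun=> false].

Let Lcoord_perm p x s : Lcoord (unsigned p x) s = Lcoord x (Lperm p s).
Proof. by case: s => [[b i]|] //=; rewrite mxE ffunE mul1r. Qed.

Lemma orbit_comp p f L (M : {vspace 'rV[R]_n}) :
  orbit_B (linfun (@signed_perm R n p f) @: L) M -> orbit_B L M.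
Proof.
move=> [q [g ->]]; exists (q * p)%g, [ffun i => g i (+) f (q i)].
rewrite -limg_comp; congr (_ @: _)%VS; apply/lfunP => x.
rewrite comp_lfunE !lfunE /=; apply/rowP => i.
by rewrite !mxE ffunE permM mulrA signr_addb.
Qed.

(** The coordinate permutations [p] and its inverse map the two flats onto each other, so each orbit
    contains the other. *)
Lemma part_type_perm (e e' : rel (Lambda n)) p :
  signed_equivalence e -> signed_equivalence e' ->
  (forall s t, e' s t = e (Lperm p s) (Lperm p t)) ->
  part_type R (rel_part e) = part_type R (rel_part e').
Proof.
move=> He He' ee'.
have [L [fL -> LP]] := signed_flat R He; have [L' [fL' -> LP']] := signed_flat R He'.
have LpermK s : Lperm p (Lperm p^-1 s) = s by case: s => [[b i]|] //=; rewrite permKV.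
have imL : L' = (linfun (unsigned p) @: L)%VS.
  apply/vspaceP => x; apply/idP/memv_imgP => [/LP' xL'|[y /LP yL ->]].
    exists (unsigned p^-1 x).
      apply/LP => s t st; rewrite !Lcoord_perm; apply: xL'.
      by rewrite ee' !LpermK.
    apply/rowP => i; rewrite lfunE /= !mxE !ffunE !mul1r.
    by rewrite permK.
  apply/LP' => s t; rewrite ee' lfunE !Lcoord_perm; exact: yL.
have imL' : L = (linfun (unsigned p^-1) @: L')%VS.
  apply/vspaceP => x; apply/idP/memv_imgP => [/LP xL|[y /LP' yL' ->]].
    exists (unsigned p x).
      by apply/LP' => s t; rewrite ee' !Lcoord_perm; apply: xL.
    apply/rowP => i; rewrite lfunE /= !mxE !ffunE !mul1r.
    by rewrite permKV.
  apply/LP => s t st; rewrite lfunE !Lcoord_perm; apply: yL'.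
  by rewrite ee' !LpermK.
rewrite !part_type_Part //; apply/seteqP; split=> M.
  by rewrite {1}imL'; apply: orbit_comp.
by rewrite {1}imL; apply: orbit_comp.
Qed.
End Types.

(* The position in [sigma_B nu] of the entry number [x] of [nu], if [size nu = k]. *)
Definition sigma_pos k x :=
  if odd k && (x < k) then
    if x < k./2 then x else if x == k./2 then k.-1 else x.-1
  else x.

Lemma nth_sigma_B nu x : x < size nu ->
  nth 0 (sigma_B nu) (sigma_pos (size nu) x) = nth 0 nu x.
Proof.
rewrite /sigma_B /sigma_pos => xk; rewrite xk andbT; case: ifP => // o.
have := odd_double_half (size nu); rewrite o; set m := (size nu)./2 => kE.
have sm : size (take m nu) = m by rewrite size_take; case: ifP; lia.
have sd : size (drop m.+1 nu) = m by rewrite size_drop; lia.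
rewrite !nth_cat sm sd; case: (ltngtP x m) => xm.
- by rewrite xm nth_take.
- rewrite ifF; last by lia.
  rewrite ifT; last by lia.
  by rewrite nth_drop; congr nth; lia.
- rewrite ifF; last by lia.
  rewrite ifF; last by lia.
  have -> : (size nu).-1 - m - m = 0 by lia.
  by rewrite /= xm.
Qed.

Lemma sigma_pos_lt k x : (sigma_pos k x < k) = (x < k).
Proof.
rewrite /sigma_pos; have := odd_double_half k; case: (odd k) => //=.
by case: (ltnP x k) => //= xk kE; case: (ltngtP x k./2); lia.
Qed.

Lemma sigma_pos_id k x : k <= x -> sigma_pos k x = x.
Proof. by move=> kx; rewrite /sigma_pos ltnNge kx andbF. Qed.

Lemma sigma_pos_inj k : injective (sigma_pos k).
Proof.
move=> x y; case: (ltnP x k) => xk; case: (ltnP y k) => yk; last by rewrite !sigma_pos_id.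
- rewrite /sigma_pos xk yk !andbT; have := odd_double_half k.
  case: (odd k) => //= kE.
  by case: (ltngtP x k./2); case: (ltngtP y k./2); lia.
- have := sigma_pos_lt k x; rewrite xk (sigma_pos_id yk) => + e; rewrite e; lia.
- have := sigma_pos_lt k y; rewrite yk (sigma_pos_id xk) => + e; rewrite -e; lia.
Qed.

Lemma sigma_pos_surj k y : exists x, sigma_pos k x = y.
Proof.
case: (boolP (odd k && (y < k))) => [/andP[o yk]|nk]; last first.
  by exists y; rewrite /sigma_pos (negbTE nk).
have := odd_double_half k; rewrite o => kE.
case: (ltnP y k./2) => yh; first by exists y; rewrite /sigma_pos o yk yh.
case: (eqVneq y k.-1) => [->|ny].
  by exists k./2; rewrite /sigma_pos o ltnn eqxx ifT //; lia.
exists y.+1; rewrite /sigma_pos o ifT; last by lia.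
by rewrite ifF ?ifF //; lia.
Qed.

Lemma sigma_B_perm nu : perm_eq (sigma_B nu) nu.
Proof.
rewrite /sigma_B; case: ifP => // o.
have mk : (size nu)./2 < size nu by have := odd_double_half (size nu); rewrite o; lia.
rewrite -[X in perm_eq _ X](cat_take_drop (size nu)./2 nu) perm_cat2l (drop_nth 0 mk).
by rewrite perm_catC.
Qed.

Lemma sigma_B_inj : injective sigma_B.
Proof.
move=> nu nu' e.
have sz : size nu = size nu'.
  by rewrite -(perm_size (sigma_B_perm nu)) e (perm_size (sigma_B_perm nu')).
apply: (@eq_from_nth _ 0) => // x xk.
by rewrite -nth_sigma_B // e sz nth_sigma_B // -sz.
Qed.

Lemma sigma_B_surj nu' : exists nu, sigma_B nu = nu'.
Proof.
pose nu := mkseq (fun x => nth 0 nu' (sigma_pos (size nu') x)) (size nu').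
have sz : size nu = size nu' by rewrite size_mkseq.
exists nu; apply: (@eq_from_nth _ 0); first by rewrite (perm_size (sigma_B_perm nu)).
move=> y; rewrite (perm_size (sigma_B_perm nu)) sz => yk.
have [x xy] := sigma_pos_surj (size nu') y.
have xk : x < size nu' by rewrite -sigma_pos_lt xy.
by rewrite -xy -{1}sz nth_sigma_B ?sz // nth_mkseq.
Qed.

(** * The correspondence *)

Section Matching.
Variable n : nat.
Implicit Types (k : nat) (W c : nat -> nat).

Definition word_a k c := [seq (x - k).+1 | x <- iota k n & 0 < c x].
Definition word_mu k c := [seq c x | x <- iota k n & 0 < c x].
Definition word_nu k c := [seq (c x).-1 | x <- iota 0 k].

(** [1 < c j] gives a switching block a positive element besides its virtual position. *)
Definition extended_word key k c W :=
  [/\ block_word (k + n) c W, forall j, j < k -> 1 < c j & greedy key (k + n) W].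

Definition nc_part k W := word_part n k W (nc_tau k) (nc_zero k).
Definition nn_part k W := word_part n k W (nn_tau k) (nn_zero k).

Lemma nth_word_nu k c x : x < k -> nth 0 (word_nu k c) x = (c x).-1.
Proof. by move=> xk; rewrite (nth_map 0) ?size_iota // nth_iota. Qed.

Lemma size_word_nu k c : size (word_nu k c) = k.
Proof. by rewrite size_map size_iota. Qed.

Lemma word_stats_inj k c c' : word_a k c = word_a k c' -> word_mu k c = word_mu k c' ->
  forall x, k <= x -> x < k + n -> c x = c' x.
Proof.
move=> ea emu x kx xN.
have ef : [seq x <- iota k n | 0 < c x] = [seq x <- iota k n | 0 < c' x].
  move: ea; rewrite /word_a => /(congr1 (map (fun y => y.-1 + k))).
  rewrite -!map_comp.
  have H f : [seq ((fun y => y.-1 + k) \o (fun x => (x - k).+1)) i | i <- iota k n & 0 < f i] =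
      [seq x <- iota k n | 0 < f x].
    rewrite -[RHS]map_id; apply/eq_in_map => y; rewrite mem_filter mem_iota /=; lia.
  by rewrite !H.
have xi : x \in iota k n by rewrite mem_iota kx.
case: (posnP (c x)) => cx.
  have : x \notin [seq x <- iota k n | 0 < c x] by rewrite mem_filter cx.
  by rewrite ef mem_filter xi andbT cx lt0n negbK => /eqP.
move: emu; rewrite /word_mu -ef => /eq_in_map; apply.
by rewrite mem_filter cx.
Qed.

(** The first [t.+1] positions carry letters at most [t], and each letter occurs no more often than
    its total size. *)
Lemma block_word_ballot N c W t : block_word N c W -> t < N -> t < \sum_(s < t.+1) c s.
Proof.
move=> [W1 W2 _] tN; rewrite -[X in X <= _](@cnt_sum W t.+1).
  apply: leq_sum => l _; rewrite -W2; last by have := ltn_ord l; lia.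
  exact: leq_cnt.
by move=> s st; apply: W1; lia.
Qed.

Lemma block_word_total N c W : block_word N c W -> \sum_(s < N) c s = N.
Proof.
by move=> [W1 W2 _]; rewrite -[RHS](cnt_sum W1); apply: eq_bigr => l _; rewrite W2.
Qed.

Lemma sum_nth_succ (s : seq nat) k : size s = k ->
  \sum_(x < k) (nth 0 s x).+1 = sumn s + k.
Proof.
move=> <-; elim: s => [|x s IH]; first by rewrite big_ord0.
by rewrite /= big_ord_recl /= IH; lia.
Qed.

(** Permuting the sizes at the virtual positions keeps every partial sum that contains all of them,
    and shorter sums satisfy the ballot condition because these sizes are positive. The given word
    may be greedy for another key, or for none. *)
Lemma extended_word_exists key k c W nu : block_word (k + n) c W ->
  (forall j, j < k -> 1 < c j) -> perm_eq nu (word_nu k c) ->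
  exists c' W', [/\ extended_word key k c' W', word_a k c' = word_a k c,
    word_mu k c' = word_mu k c & word_nu k c' = nu].
Proof.
move=> Wc ck pnu; have sz : size nu = k by rewrite (perm_size pnu) size_word_nu.
(* The successor adds the virtual position to the positive elements. *)
pose c' x := if x < k then (nth 0 nu x).+1 else c x.
have c'k x : k <= x -> c' x = c x by rewrite /c' ltnNge => ->.
have ck' j : j < k -> 1 < c' j.
  move=> jk; rewrite /c' jk ltnS.
  have : nth 0 nu j \in word_nu k c by rewrite -(perm_mem pnu) mem_nth ?sz.
  by move=> /mapP[x]; rewrite mem_iota /= => /ck; lia.
have sum_k t : k <= t -> \sum_(s < t) c' s = \sum_(s < t) c s.
  move=> /subnKC <-; elim: (t - k) => [|d IH]; last first.
    by rewrite addnS !big_ord_recr /= IH c'k ?leq_addr.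
  rewrite addn0; under eq_bigr => x _ do rewrite /c' ltn_ord.
  rewrite (sum_nth_succ sz) (perm_sumn pnu) -(sum_nth_succ (size_word_nu k c)).
  by apply: eq_bigr => x _; rewrite nth_word_nu // prednK // ltnW // ck.
have [t tN||W' [Wc' gW']] := @greedy_exists key (k + n) c'.
- case: (ltnP t k) => tk; last by rewrite sum_k; [apply: block_word_ballot Wc tN|lia].
  rewrite -[X in X <= _]card_ord -sum1_card; apply: leq_sum => s _.
  by have := ltn_ord s; have := ck' s; lia.
- by rewrite sum_k ?leq_addr // (block_word_total Wc).
exists c', W'; split=> //.
- rewrite /word_a; congr map; apply: eq_in_filter => x.
  by rewrite mem_iota => /andP[kx _]; rewrite c'k.
- rewrite /word_mu.
  have -> : [seq x <- iota k n | 0 < c' x] = [seq x <- iota k n | 0 < c x].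
    by apply: eq_in_filter => x; rewrite mem_iota => /andP[kx _]; rewrite c'k.
  by apply/eq_in_map => x; rewrite mem_filter mem_iota => /and3P[_ kx _]; rewrite c'k.
- apply: (@eq_from_nth _ 0) => [|x]; rewrite size_word_nu // => xk.
  by rewrite nth_word_nu // /c' xk.
Qed.

Lemma extended_word_unique key k c c' W W' :
  (forall s t, s < k + n -> t < k + n -> key s = key t -> s = t) ->
  extended_word key k c W -> extended_word key k c' W' ->
  word_a k c = word_a k c' -> word_mu k c = word_mu k c' -> word_nu k c = word_nu k c' ->
  forall t, t < k + n -> W t = W' t.
Proof.
move=> key_inj [Wc ck gW] [[W1 W2 W3] ck' gW'] ea emu enu.
have cc' x : x < k + n -> c x = c' x.
  move=> xN; case: (ltnP x k) => xk; last exact: (word_stats_inj ea emu).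
  have := congr1 (nth 0 ^~ x) enu; rewrite /= !nth_word_nu //.
  by have := ck x xk; have := ck' x xk; lia.
apply: (greedy_unique key_inj Wc _ gW gW'); split=> // [l lN|t tN].
  by rewrite W2 // cc'.
by rewrite cc' //; apply: W3.
Qed.

Section Realization.
Variable R : realType.

Lemma nc_part_word (P : {set {set Lambda n}}) : classical_noncrossing R P ->
  exists k c W, extended_word (nc_key k) k c W /\ P = nc_part k W.
Proof.
move=> [/classical_signed[e He ->] nc].
exists #|switch_mins e|, (cnt (part_word e) (#|switch_mins e| + n)), (part_word e); split.
  split; [exact: part_word_block|exact: part_word_cnt|exact: noncrossing_greedy].
apply: rel_partE; apply: part_word_label => //; first exact: noncrossing_rank.
exact: noncrossing_zero.
Qed.

Lemma nn_part_word (P : {set {set Lambda n}}) : classical_nonnesting R P ->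
  exists k c W, extended_word (nn_key (k + n)) k c W /\ P = nn_part k W.
Proof.
move=> [/classical_signed[e He ->] nn].
exists #|switch_mins e|, (cnt (part_word e) (#|switch_mins e| + n)), (part_word e); split.
  split; [exact: part_word_block|exact: part_word_cnt|exact: nonnesting_greedy].
apply: rel_partE; apply: part_word_label => //; first exact: nonnesting_rank.
exact: nonnesting_zero.
Qed.

Lemma nc_part_classical k c W : extended_word (nc_key k) k c W ->
  classical_noncrossing R (nc_part k W).
Proof.
move=> [Wc ck gW]; split; last exact: nc_word_part Wc ck gW.
by apply: signed_classical; apply: word_label_signed; apply: nc_involution.
Qed.

Lemma nn_part_classical k c W : extended_word (nn_key (k + n)) k c W ->
  classical_nonnesting R (nn_part k W).
Proof.
move=> [Wc ck gW]; split; last exact: nn_word_part Wc ck gW.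
by apply: signed_classical; apply: word_label_signed; apply: nn_involution.
Qed.

Lemma nc_part_stats k c W : extended_word (nc_key k) k c W ->
  [/\ stat_a (nc_part k W) = word_a k c, stat_mu (nc_part k W) = word_mu k c
    & stat_nu (nc_part k W) = word_nu k c].
Proof.
move=> [Wc ck gW]; have fm := nc_first_mono Wc ck gW; have tauP := nc_involution k.
by split; [apply: word_stat_a|apply: word_stat_mu|apply: word_stat_nu].
Qed.

Lemma nn_part_stats k c W : extended_word (nn_key (k + n)) k c W ->
  [/\ stat_a (nn_part k W) = word_a k c, stat_mu (nn_part k W) = word_mu k c
    & stat_nu (nn_part k W) = word_nu k c].
Proof.
move=> [Wc ck gW]; have fm := nn_first_mono Wc ck gW; have tauP := nn_involution k.
by split; [apply: word_stat_a|apply: word_stat_mu|apply: word_stat_nu].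
Qed.

Lemma noncrossing_unique (P Q : {set {set Lambda n}}) :
  classical_noncrossing R P -> classical_noncrossing R Q ->
  stat_a P = stat_a Q -> stat_mu P = stat_mu Q -> stat_nu P = stat_nu Q -> P = Q.
Proof.
move=> /nc_part_word[k [c [W [Wc ->]]]] /nc_part_word[k' [c' [W' [Wc' ->]]]].
have [-> -> ->] := nc_part_stats Wc; have [-> -> ->] := nc_part_stats Wc' => ea emu enu.
have kk : k = k' by rewrite -(size_word_nu k c) enu size_word_nu.
subst k'; apply: eq_word_part; apply: extended_word_unique Wc Wc' ea emu enu.
by move=> s t _ _; apply: nc_key_inj.
Qed.

Lemma nonnesting_unique (P Q : {set {set Lambda n}}) :
  classical_nonnesting R P -> classical_nonnesting R Q ->
  stat_a P = stat_a Q -> stat_mu P = stat_mu Q -> stat_nu P = stat_nu Q -> P = Q.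
Proof.
move=> /nn_part_word[k [c [W [Wc ->]]]] /nn_part_word[k' [c' [W' [Wc' ->]]]].
have [-> -> ->] := nn_part_stats Wc; have [-> -> ->] := nn_part_stats Wc' => ea emu enu.
have kk : k = k' by rewrite -(size_word_nu k c) enu size_word_nu.
subst k'; apply: eq_word_part; apply: extended_word_unique Wc Wc' ea emu enu.
exact: nn_key_inj.
Qed.

(** For odd [k], [sigma_pos] moves the middle letter, fixed by the reversal, to the end and keeps
    the order of the others; so it carries the reversal of all letters to that of the first
    [k - 1]. *)
Lemma sigma_pos_tau k x : x < k -> nn_tau k (sigma_pos k x) = sigma_pos k (nc_tau k x).
Proof.
move=> xk; have := odd_double_half k; rewrite /nn_tau /nc_tau /sigma_pos xk.
have -> : k - x.+1 < k by lia.
case: (odd k) => /= kE; last by rewrite ifT; lia.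
case: (ltngtP x k./2) => xh.
- rewrite ifT; last by lia.
  rewrite ifF; last by lia.
  by rewrite ifF; lia.
- rewrite ifT; last by lia.
  by rewrite ifT; lia.
- rewrite ifF; last by lia.
  rewrite ifF; last by lia.
  by rewrite ifT; lia.
Qed.

Lemma sigma_pos_zero k : odd k -> sigma_pos k (nc_zero k) = nn_zero k.
Proof.
move=> o; have := odd_double_half k; rewrite /sigma_pos /nc_zero /nn_zero o ltnn eqxx => kE.
by rewrite ifT //; lia.
Qed.

Lemma count_mktuple (f : 'I_n -> nat) y : count_mem y [tuple f i | i < n] = #|[set i | f i == y]|.
Proof.
by rewrite /= count_map cardsE cardE size_filter enumT.
Qed.

(** Up to [sigma_pos] every letter occurs equally often in both words, so a permutation of the
    coordinates carries one word to the other. As [sigma_pos] also respects negation and the zero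
    letter, this permutation identifies the two relations. *)
Lemma matching_part_type k c c' W W' :
  extended_word (nc_key k) k c W -> extended_word (nn_key (k + n)) k c' W' ->
  (forall x, x < k + n -> c' (sigma_pos k x) = c x) ->
  part_type R (nc_part k W) = part_type R (nn_part k W').
Proof.
move=> [Wc ck gW] [Wc' ck' gW'] cc'.
have W_lt (i : 'I_n) : W (k + i) < k + n.
  by case: Wc => /(_ (k + i)); rewrite ltn_add2l ltn_ord => /(_ isT); have := ltn_ord i; lia.
have W_lt' (i : 'I_n) : W' (k + i) < k + n.
  by case: Wc' => /(_ (k + i)); rewrite ltn_add2l ltn_ord => /(_ isT); have := ltn_ord i; lia.
have sN x : (sigma_pos k x < k + n) = (x < k + n).
  case: (ltnP x k) => xk; last by rewrite sigma_pos_id.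
  by have := sigma_pos_lt k x; rewrite xk; lia.
have : perm_eq [tuple W' (k + i) | i < n] [tuple sigma_pos k (W (k + i)) | i < n].
  apply/allP => y _ /=; apply/eqP; rewrite !count_mktuple.
  have [x xy] := sigma_pos_surj k y; rewrite -{}xy.
  have -> : [set i : 'I_n | sigma_pos k (W (k + i)) == sigma_pos k x] =
      [set i : 'I_n | W (k + i) == x].
    by apply/setP => i; rewrite !inE (inj_eq (@sigma_pos_inj k)).
  case: (ltnP x (k + n)) => xN.
    have yN : sigma_pos k x < k + n by rewrite sN.
    have := card_letter Wc' ck' yN; rewrite cc' // -(card_letter Wc ck xN) sigma_pos_lt.
    exact: addnI.
  (* Letters from [k + n] on occur in neither word. *)
  rewrite !eq_card0 // => i; rewrite inE; apply/negP => /eqP E.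
    by have := W_lt i; rewrite E; lia.
  by have := W_lt' i; rewrite E sN; lia.
move=> /tuple_permP[p pE].
have WE (i : 'I_n) : W' (k + i) = sigma_pos k (W (k + p i)).
  by have := congr1 (fun t : n.-tuple nat => tnth t i) (val_inj pE); rewrite !tnth_mktuple.
pose relabel (l : option (bool * nat)) := omap (fun q => (q.1, sigma_pos k q.2)) l.
have relabel_inj : injective relabel.
  by move=> [[b x]|] [[b' y]|] //= [-> /sigma_pos_inj ->].
apply: (@part_type_perm _ _ _ _ p).
- by apply: word_label_signed; apply: nc_involution.
- by apply: word_label_signed; apply: nn_involution.
have labE s : word_label k W' (nn_tau k) (nn_zero k) s =
    relabel (word_label k W (nc_tau k) (nc_zero k) (Lperm p s)).
  case: s => [[b i]|] /=; last by case: ifP => // o; rewrite /= sigma_pos_zero.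
  rewrite WE sigma_pos_lt; case: ifP => [xk|/negbT xk] /=.
    by case: b => //; rewrite sigma_pos_tau.
  by rewrite sigma_pos_id // leqNgt.
by move=> s t; rewrite !labE (inj_eq relabel_inj).
Qed.
End Realization.
End Matching.

Theorem theorem2p9 (R : realType) (n : nat) :
  [/\ forall pi : {set {set Lambda n}}, classical_noncrossing R pi ->
        exists! pi' : {set {set Lambda n}},
          classical_nonnesting R pi' /\ matching pi pi',
      forall pi' : {set {set Lambda n}}, classical_nonnesting R pi' ->
        exists! pi : {set {set Lambda n}},
          classical_noncrossing R pi /\ matching pi pi'
    & forall pi pi' : {set {set Lambda n}},
        classical_noncrossing R pi -> classical_nonnesting R pi' ->
        matching pi pi' -> part_type R pi = part_type R pi'].
Proof.
split=> [pi /nc_part_word[k [c [W [Wc ->]]]]|pi' /nn_part_word[k [c [W [Wc ->]]]]|].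
- have [sa smu snu] := nc_part_stats Wc; have [bw ck _] := Wc.
  (* The noncrossing word supplies the ballot condition; the queue word with the sizes rearranged by
     [sigma_B] is the required partition. *)
  have [c' [W' [Wc' ea emu enu]]] :=
    extended_word_exists (nn_key (k + n)) bw ck (sigma_B_perm (word_nu k c)).
  have [sa' smu' snu'] := nn_part_stats Wc'.
  have m : matching (nc_part n k W) (nn_part n k W').
    by split; rewrite ?sa ?smu ?snu ?sa' ?smu' ?snu'.
  exists (nn_part n k W'); split; first by split=> //; apply: nn_part_classical Wc'.
  move=> Q [nnQ [Qa Qmu Qnu]]; case: m => [ma mmu mnu].
  apply: (@nonnesting_unique n R) => //; first exact: nn_part_classical Wc'.
  - by rewrite ma Qa.
  - by rewrite mmu Qmu.
  - by rewrite mnu Qnu.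
- have [sa smu snu] := nn_part_stats Wc; have [bw ck _] := Wc.
  have [nu nuE] := sigma_B_surj (word_nu k c).
  have pnu : perm_eq nu (word_nu k c) by rewrite -nuE perm_sym sigma_B_perm.
  have [c' [W' [Wc' ea emu enu]]] := extended_word_exists (nc_key k) bw ck pnu.
  have [sa' smu' snu'] := nc_part_stats Wc'.
  have m : matching (nc_part n k W') (nn_part n k W).
    by split; rewrite ?sa ?smu ?snu ?sa' ?smu' ?snu' // enu.
  exists (nc_part n k W'); split; first by split=> //; apply: nc_part_classical Wc'.
  move=> Q [ncQ [Qa Qmu Qnu]]; case: m => [ma mmu mnu].
  apply: (@noncrossing_unique n R) => //; first exact: nc_part_classical Wc'.
  - by rewrite -ma Qa.
  - by rewrite -mmu Qmu.
  - by apply: sigma_B_inj; rewrite -mnu Qnu.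
- move=> pi pi' /nc_part_word[k [c [W [Wc ->]]]] /nn_part_word[k' [c' [W' [Wc' ->]]]].
  have [sa smu snu] := nc_part_stats Wc; have [sa' smu' snu'] := nn_part_stats Wc'.
  rewrite /matching sa smu snu sa' smu' snu' => -[ea emu enu].
  have kk : k' = k.
    by rewrite -(size_word_nu k' c') enu (perm_size (sigma_B_perm _)) size_word_nu.
  (* The three equalities of statistics say that the sizes agree along [sigma_pos]: for real
     positions by [a] and [mu], for virtual ones by [nu]. *)
  subst k'; apply: (matching_part_type R Wc Wc') => x xN.
  case: (ltnP x k) => xk; last by rewrite sigma_pos_id //; apply: (word_stats_inj ea emu).
  have := @nth_sigma_B (word_nu k c) x; rewrite size_word_nu => /(_ xk).
  have yk : sigma_pos k x < k by rewrite sigma_pos_lt.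
  rewrite -enu !nth_word_nu //.
  by case: Wc Wc' => [_ /(_ _ xk) ? _] [_ /(_ _ yk) ? _]; lia.
Qed.
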